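(* Let $R$ be an integer with $|R|\ge2$ and $B=\{0,b\}$ with $b\in\mathbb{Z}$, $b\ne0$. Let $L\subset\mathbb{Z}$ be finite with $0\in L$ and $(\alpha_l)_{l\in L}$ nonzero complex numbers with $\alpha_0=1$. The matrix $\frac{1}{\sqrt2}\left(e^{2\pi i lc/R}\alpha_l\right)_{l\in L,c\in B}$ has orthonormal columns if and only if the following four conditions hold: (i) $R=2^\alpha r$ with $\alpha\in\mathbb{N}$ ($\alpha\ge1$) and $r$ odd; (ii) $b=2^\beta q$ with $\beta\in\mathbb{N}\cup\{0\}$, $\beta\le\alpha-1$, and $q$ odd; (iii) every $l\in L\setminus\{0\}$ is of the form $l=2^{\alpha-1-\beta}s$ with $s$ odd and $qs$ divisible by $r$; (iv) $\sum_{l\in L\setminus\{0\}}|\alpha_l|^2=1$. If in addition (v) there exist $l_1,l_2\in L\setminus\{0\}$ with $l_1\not\equiv l_2\pmod R$, then $\left\{\Big(\prod_{j=0}^k\alpha_{l_j}\Big)e_{l_0+Rl_1+\dots+R^kl_k}: l_0\dots l_k\in\Omega(L)\right\}$ is a Parseval frame for $L^2(\mu(R,B))$.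
   Context: $\mu(R,B)$ is the unique Borel probability measure on $\mathbb{R}$ with $\mu(E)=\frac12(\mu(\tau_0^{-1}E)+\mu(\tau_b^{-1}E))$, $\tau_c(x)=(x+c)/R$. $e_\lambda(x)=e^{2\pi i\lambda x}$. $\Omega(L)$: the empty word (giving $e_0$ with weight 1) and all words $l_0\dots l_k$ with $l_i\in L$, $l_k\ne0$. Parseval frame: $\sum_i|\langle v,f_i\rangle|^2=\|v\|^2$ for all $v$. *)

(* Defs.v *)
From HB Require Import structures.
From mathcomp Require Import all_boot all_order all_algebra.
From mathcomp Require Import all_classical all_reals all_analysis.
From mathcomp Require Import complex.
Import Order.TTheory GRing.Theory Num.Theory.

Set Implicit Arguments.
Unset Strict Implicit.
Unset Printing Implicit Defensive.

Local Open Scope classical_set_scope.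
Local Open Scope ring_scope.

Section Defs.
Variable K : realType.

Definition ephase (x : K) : K[i] := Complex (cos (2 * pi * x)) (sin (2 * pi * x)).

Definition e_ (lam : int) (x : K) : K[i] := ephase (lam%:~R * x).

Definition tau (R c : int) (x : K) : K := (x + c%:~R) / R%:~R.

Definition selfsimilar (R b : int) (mu : probability K K) : Prop :=
  forall E : set K, measurable E ->
    mu E = ((2^-1 : K)%:E * (mu (tau R 0 @^-1` E) + mu (tau R b @^-1` E)))%E.

Definition Mentry (R : int) (alpha : int -> K[i]) (l c : int) : K[i] :=
  ((Num.sqrt (2 : K))^-1)%:C%C * ephase ((l * c)%:~R / R%:~R) * alpha l.

Definition orthonormal_columns (R b : int) (L : seq int) (alpha : int -> K[i]) :=
  forall c c' : int, c \in [:: 0; b] -> c' \in [:: 0; b] ->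
    \sum_(l <- L) Mentry R alpha l c * conjc (Mentry R alpha l c')
      = (c == c')%:R.

Definition conditions_i_iv (R b : int) (L : seq int) (alpha : int -> K[i]) :=
  (exists (a : nat) (r : int) (be : nat) (q : int),
     [/\ (1 <= a)%N /\ R = 2 ^+ a * r /\ odd (absz r),
         b = 2 ^+ be * q /\ (be <= a - 1)%N /\ odd (absz q)
       & forall l, l \in L -> l != 0 ->
           exists s : int, [/\ l = 2 ^+ (a - 1 - be) * s, odd (absz s)
                             & (r %| q * s)%Z]])
  /\ \sum_(l <- L | l != 0) Normc.normc (alpha l) ^+ 2 = 1.

Definition condition_v (R : int) (L : seq int) :=
  exists l1 l2 : int, [/\ l1 \in L, l2 \in L, l1 != 0, l2 != 0
                        & ~~ (R %| l1 - l2)%Z].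

Definition Omega (L : seq int) : set (seq int) :=
  [set w | all (fun l => l \in L) w /\ (w = [::] \/ last 0 w != 0)].

Definition freq (R : int) (w : seq int) : int :=
  \sum_(j < size w) R ^+ j * nth 0 w j.

Definition frame_elt (R : int) (alpha : int -> K[i]) (w : seq int) (x : K) : K[i] :=
  (\prod_(l <- w) alpha l) * e_ (freq R w) x.

Definition cintegral (mu : probability K K) (g : K -> K[i]) : K[i] :=
  Complex (fine (\int[mu]_x (complex.Re (g x))%:E)) (fine (\int[mu]_x (complex.Im (g x))%:E)).

Definition inL2 (mu : probability K K) (v : K -> K[i]) : Prop :=
  [/\ measurable_fun setT (fun x => complex.Re (v x)),
      measurable_fun setT (fun x => complex.Im (v x))
    & mu.-integrable setT (fun x => (Normc.normc (v x) ^+ 2)%:E)].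

Definition inner (mu : probability K K) (v f : K -> K[i]) : K[i] :=
  cintegral mu (fun x => v x * conjc (f x)).

Definition parseval_frame (I : choiceType) (Idx : set I) (mu : probability K K)
    (f : I -> K -> K[i]) : Prop :=
  forall v, inL2 mu v ->
    (\esum_(i in Idx) (Normc.normc (inner mu v (f i)) ^+ 2)%:E
      = \int[mu]_x (Normc.normc (v x) ^+ 2)%:E)%E.

End Defs.

(* Main.v *)
(* Write [S_l] for the map [f |-> alpha_l e_l f(R x)] on 1-periodic functions of
   [L^2(mu)].  Self-similarity computes its adjoint [dualop l], and orthonormality
   of the columns says [sum_l |dualop l v|^2 = |v|^2]; moreover [dualop 0 1 = 1].
   As [<v, f_(l w)> = <dualop l v, f_w>] and a final letter 0 does not change
   [f_w], the sum of [|<v, f_w>|^2] over the words of [Omega L] of length at most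
   [k] is [energy k v], which increases with [k] and is at most [|v|^2].  The [v]
   with [energy k v --> |v|^2] thus form a closed subspace, and since exponentials
   span a dense subspace it suffices to take [v = e_t] with [t] real.

   There [dualop l e_t] is a multiple of [e_s] with [s = (t - l) / R], and
   [D_k(t) = |e_t|^2 - energy k e_t] obeys the Markov recursion of the walk
   [t |-> (t - l) / R] whose step to [s] has probability
   [|alpha_l|^2 cos^2(pi b s)].  If [D_k] does not tend to 0 uniformly on a compact
   interval, the points where [lim D_k] is maximal form a nonempty closed set,
   stable under the possible steps and not containing 0.  From each of its points
   the path [t / R^k --> 0] is blocked, i.e. [b t / R^(k+1)] is a half-integer for
   some [k].  Hence all its points lie in [(1/b) Z]; following them along further
   steps, even in [(1/b') Z] with [b'] the part of [b] prime to [R].  At a blocked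
   point all steps [l != 0] are possible, so [b' (l1 - l2) / R] is an integer for
   all nonzero [l1], [l2] in [L], against (v). *)
Require Import Defs.
From mathcomp Require Import all_boot all_order all_algebra.
From mathcomp Require Import all_classical all_reals all_analysis measurable_realfun.
From mathcomp Require Import complex.
From mathcomp Require Import ring lra zify.
Import Order.TTheory GRing.Theory Num.Theory.
Import numFieldNormedType.Exports.
Import HBNNSimple.

Set Implicit Arguments.
Unset Strict Implicit.
Unset Printing Implicit Defensive.

Local Open Scope classical_set_scope.
Local Open Scope ring_scope.

Local Arguments Normc.normc {R} x : simpl never.

Local Notation sqnormc z := (Normc.normc z ^+ 2).

Section SquaredModulus.
Variable R : rcfType.
Implicit Types (x : R) (z w : R[i]).

Lemma sqnormcE z : sqnormc z = complex.Re z ^+ 2 + complex.Im z ^+ 2.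
Proof. by case: z => a c; rewrite /Normc.normc sqr_sqrtr // addr_ge0 // sqr_ge0. Qed.

Lemma sqnormc_eq0 z : (sqnormc z == 0) = (z == 0).
Proof.
by rewrite sqnormcE paddr_eq0 ?sqr_ge0 // !sqrf_eq0; case: z => a c; rewrite eq_complex.
Qed.

Lemma sqnormcM z w : sqnormc (z * w) = sqnormc z * sqnormc w.
Proof. by rewrite Normc.normcM exprMn. Qed.

Lemma sqnormcJ z : sqnormc (conjc z) = sqnormc z.
Proof. by rewrite !sqnormcE; case: z => a c /=; rewrite sqrrN. Qed.

Lemma sqnormcR x : sqnormc x%:C%C = x ^+ 2.
Proof. by rewrite sqnormcE /= expr0n addr0. Qed.

Lemma sqnormc1 : sqnormc (1 : R[i]) = 1.
Proof. by rewrite Normc.normc1 expr1n. Qed.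

Lemma conjcM z w : conjc (z * w) = conjc z * conjc w.
Proof. exact: rmorphM. Qed.

Lemma mulcJ z : z * conjc z = (sqnormc z)%:C%C.
Proof.
by rewrite sqnormcE; case: z => a c; rewrite /real_complex_def; simpc; congr Complex; ring.
Qed.

Lemma mul_sqrtVC x : 0 <= x ->
  ((Num.sqrt x)^-1)%:C%C * ((Num.sqrt x)^-1)%:C%C = (x^-1)%:C%C.
Proof. by move=> x_ge0; rewrite -rmorphM /= -invfM -expr2 sqr_sqrtr. Qed.

Lemma sqnormc_parallelogram z w :
  sqnormc (z + w) + sqnormc (z - w) = 2 * sqnormc z + 2 * sqnormc w.
Proof. by rewrite !sqnormcE; case: z w => a c [d e] /=; ring. Qed.

Lemma sqnormcD_le z w : sqnormc (z + w) <= 2 * sqnormc z + 2 * sqnormc w.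
Proof. by rewrite -sqnormc_parallelogram lerDl sqr_ge0. Qed.

Lemma orthonormal_columns_isometry (I J : eqType) (L : seq I) (B : seq J)
    (M : I -> J -> R[i]) (v : J -> R[i]) : uniq B ->
    {in B &, forall c d, \sum_(l <- L) M l c * conjc (M l d) = (c == d)%:R} ->
  \sum_(l <- L) sqnormc (\sum_(c <- B) conjc (M l c) * v c) = \sum_(c <- B) sqnormc (v c).
Proof.
move=> uniqB orthoM; apply: (@complexI R); rewrite !rmorph_sum /=.
transitivity (\sum_(d <- B) \sum_(c <- B) v c * conjc (v d) *
    \sum_(l <- L) M l d * conjc (M l c)).
  under eq_bigr => l _ do rewrite -mulcJ rmorph_sum mulr_sumr.
  rewrite exchange_big; apply: eq_bigr => d _.
  under eq_bigr => l _ do rewrite mulr_suml.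
  rewrite exchange_big; apply: eq_bigr => c _; rewrite mulr_sumr; apply: eq_bigr => l _.
  by rewrite /= conjcM conjcK; ring.
rewrite [LHS]big_seq [RHS]big_seq; apply: eq_bigr => d dB.
rewrite (bigD1_seq d) //= orthoM // eqxx mulr1 mulcJ big_seq_cond big1 ?addr0 //.
by move=> c /andP[cB neq_cd]; rewrite orthoM // eq_sym (negbTE neq_cd) mulr0.
Qed.

End SquaredModulus.

Section Phase.
Variable K : realType.
Implicit Types (x y : K) (n : int).

Lemma ephaseD x y : ephase (x + y) = ephase x * ephase y.
Proof.
rewrite /ephase mulrDr cosD sinD; simpc; congr Complex.
by rewrite addrC [_ * cos _]mulrC.
Qed.

Lemma ephase0 : ephase (0 : K) = 1.
Proof. by rewrite /ephase mulr0 cos0 sin0. Qed.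

Lemma ephaseN x : ephase (- x) = conjc (ephase x).
Proof. by rewrite /ephase mulrN cosN sinN. Qed.

Lemma sqnormc_ephase x : sqnormc (ephase x) = 1.
Proof. by rewrite sqnormcE cos2Dsin2. Qed.

Lemma ephase_half : ephase (2^-1 : K) = -1.
Proof.
rewrite /ephase mulrAC divff ?pnatr_eq0 // mul1r cospi sinpi.
by apply/eqP; rewrite eq_complex /= oppr0 !eqxx.
Qed.

Lemma ephase_int n : ephase (n%:~R : K) = 1.
Proof.
have ephase1 : ephase (1 : K) = 1.
  by rewrite [X in ephase X]splitr mul1r ephaseD ephase_half mulrNN mulr1.
have ephase_nat m : ephase (m%:R : K) = 1.
  by elim: m => [|m IHm]; rewrite ?ephase0 // -natr1 ephaseD IHm ephase1 mulr1.
case: n => m; first by rewrite -pmulrn ephase_nat.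
by rewrite NegzE rmorphN /= -pmulrn ephaseN ephase_nat conjc1.
Qed.

Lemma ephaseDint x n : ephase (x + n%:~R) = ephase x.
Proof. by rewrite ephaseD ephase_int mulr1. Qed.

Definition half_integer x : Prop := exists n : int, x = n%:~R + 2^-1.

Lemma ephase_half_integer x : half_integer x -> ephase x = -1.
Proof. by case=> n ->; rewrite addrC ephaseDint ephase_half. Qed.

Lemma cos2pi_eqN1P x : cos (2 * pi * x) = -1 <-> half_integer x.
Proof.
split=> [cosxN1|/ephase_half_integer /(congr1 (@complex.Re K)) //].
set n := Num.floor x; pose y := x - (n%:~R + 2^-1).
have [y_ge y_lt] : - 2^-1 <= y /\ y < 2^-1.
  have := floor_le_tmp x; have := floorD1_gt x; rewrite -/n intrD => ? ?.
  by split; rewrite /y; lra.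
have norm_y_le : `|y| <= 2^-1 by rewrite ler_norml y_ge ltW.
have cosy1 : cos (2 * pi * y) = 1.
  have -> : 2 * pi * y = 2 * pi * (x + (- n)%:~R) - pi by rewrite rmorphN /= /y; field.
  rewrite cosB cospi sinpi mulr0 addr0.
  have /(congr1 (@complex.Re K)) /= -> := ephaseDint x (- n).
  by rewrite cosxN1 mulrNN mulr1.
have pi2_gt0 : 0 < 2 * pi :> K by rewrite mulr_gt0 ?pi_gt0.
have : 2 * pi * `|y| = 0.
  apply: cos_inj; rewrite ?in_itv /= ?lexx ?pi_ge0 //.
    by rewrite mulr_ge0 ?(ltW pi2_gt0) //= mulrAC ler_piMl ?pi_ge0 //; lra.
  by rewrite cos0 -(ger0_norm (ltW pi2_gt0)) -normrM cos_norm.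
move/eqP; rewrite mulf_eq0 gt_eqF //= normr_eq0 subr_eq0 => /eqP ->.
by exists n.
Qed.

Lemma half_integerB x y : half_integer x -> half_integer y -> ~ half_integer (x - y).
Proof.
move=> [m ->] [n ->] [k] /eqP eq_mn.
have {}eq_mn : (2 * (m - n))%:~R = (2 * k + 1)%:~R :> K.
  by rewrite !(rmorphM, rmorphB, rmorphD) /=; lra.
by move/intr_inj: eq_mn; clear; lia.
Qed.

Lemma half_integer_frac (m R : int) : R != 0 ->
  half_integer (m%:~R / R%:~R) <-> exists n : int, 2 * m = R * (2 * n + 1).
Proof.
move=> R_neq0; have R_neq0' : R%:~R != 0 :> K by rewrite intr_eq0.
split=> -[n]; last first.
  move/(congr1 (fun z : int => z%:~R : K)); rewrite !(rmorphM, rmorphD) /= => eq_m.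
  exists n; apply: (mulIf R_neq0'); rewrite mulfVK //; lra.
move=> eq_m; exists n; apply: (@intr_inj K).
have {}eq_m : m%:~R = (n%:~R + 2^-1) * R%:~R :> K by rewrite -eq_m mulfVK.
by rewrite !(rmorphM, rmorphD) /= eq_m; field.
Qed.

End Phase.

Definition half_integer_digits (K : realType) (R b : int) (L : seq int) : Prop :=
  {in L, forall l, l != 0 -> half_integer ((l * b)%:~R / R%:~R : K)}.

(** * Orthonormal columns *)

Section Dyadic.
Implicit Types (x y l r q : int).

Lemma odd_abszP x : odd `|x|%N <-> exists n, x = 2 * n + 1.
Proof. by split=> [odd_x|[n ->]]; [exists (x %/ 2)%Z; lia|lia]. Qed.

Lemma pow2_odd_decomp x : x != 0 ->
  exists (i : nat) y, x = 2 ^+ i * y /\ odd `|y|%N.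
Proof.
move=> x_neq0; have : (0 < `|x|)%N by rewrite absz_gt0.
move=> /(pfactor_coprime (isT : prime 2))[m coprime2m abs_x].
exists (logn 2 `|x|%N), (sgz x * m%:Z); split.
  move: abs_x; set k := logn _ _ => abs_x.
  by rewrite [LHS]intEsg abs_x PoszM -natrXE rmorphXn /=; ring.
by rewrite abszM absz_sg x_neq0 mul1n -coprime2n.
Qed.

Lemma pow2_odd_inj (i j : nat) x y : odd `|x|%N -> odd `|y|%N ->
  2 ^+ i * x = 2 ^+ j * y -> i = j /\ x = y.
Proof.
have even_pow2S (k : nat) (z : int) : ~~ odd (absz (2 ^+ k.+1 * z)).
  by rewrite exprS -mulrA abszM oddM.
move=> odd_x odd_y; elim: i j => [|i IHi] [|j]; rewrite ?expr0 ?mul1r //.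
- by move=> eq_x; have := even_pow2S j y; rewrite -eq_x odd_x.
- by move=> eq_y; have := even_pow2S i x; rewrite eq_y odd_y.
rewrite !exprS -!mulrA => eq_xy.
by have /IHi[-> ->] : 2 ^+ i * x = 2 ^+ j * y by apply: (@mulfI _ 2).
Qed.

Lemma dyadic_half_oddP (a be : nat) r q l : odd `|r|%N -> odd `|q|%N ->
  (exists n : int, 2 * (l * (2 ^+ be * q)) = 2 ^+ a * r * (2 * n + 1)) <->
  (be < a)%N /\
  exists s : int, [/\ l = 2 ^+ (a - 1 - be) * s, odd `|s|%N & (r %| q * s)%Z].
Proof.
move=> odd_r odd_q; split=> [[n eq_l]|[be_lt_a [s [-> odd_s /dvdzP[m eq_qs]]]]].
  have odd_rn : odd (absz (r * (2 * n + 1))).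
    by rewrite abszM oddM odd_r; apply/odd_abszP; exists n.
  have l_neq0 : l != 0.
    apply: contraTneq odd_rn => l0; move/esym/eqP: eq_l.
    by rewrite l0 mul0r mulr0 -mulrA mulf_eq0 expf_eq0 andbF orFb => /eqP ->.
  have [k [s [eq_ls odd_s]]] := pow2_odd_decomp l_neq0.
  have [||eq_a eq_qs] := @pow2_odd_inj (k + be).+1 a (q * s) (r * (2 * n + 1)) _ odd_rn.
  - by rewrite abszM oddM odd_q.
  - by rewrite [RHS]mulrA -eq_l eq_ls exprS exprD; ring.
  rewrite -eq_a; split; first by rewrite ltnS leq_addl.
  by exists s; rewrite subn1 addnK eq_qs dvdz_mulr.
have : odd `|m|%N.
  by move: (congr1 (odd \o absz) eq_qs); rewrite /= !abszM !oddM odd_q odd_s => /esym/andP[].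
move=> /odd_abszP[n eq_m]; exists n.
have eq_a : a = ((a - 1 - be) + be).+1 by move: be_lt_a; clear; lia.
move: eq_a; set k := (a - 1 - be)%N => ->; rewrite -eq_m exprS exprD.
by transitivity (2 * 2 ^+ k * 2 ^+ be * (q * s)); [ring|rewrite eq_qs; ring].
Qed.

End Dyadic.

Section OrthonormalColumns.
Variables (K : realType) (R b : int) (L : seq int) (alpha : int -> K[i]).
Hypotheses (R_neq0 : R != 0) (b_neq0 : b != 0).

Lemma conditions_i_ivP :
  conditions_i_iv R b L alpha <->
  half_integer_digits K R b L /\ \sum_(l <- L | l != 0) sqnormc (alpha l) = 1.
Proof.
split=> [[[a [r [be [q [[a_gt0 [eq_R odd_r]] [eq_b [be_le odd_q]] digitL]]]]] sum1]|].
  split=> // l lL l_neq0; apply/half_integer_frac => //; rewrite eq_R eq_b.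
  apply/dyadic_half_oddP => //; split; last exact: digitL.
  by move: a_gt0 be_le; clear; lia.
case=> half_digits sum1; split=> //.
have [a [r [eq_R odd_r]]] := pow2_odd_decomp R_neq0.
have [be [q [eq_b odd_q]]] := pow2_odd_decomp b_neq0.
have dyadicL l : l \in L -> l != 0 -> (be < a)%N /\
    exists s : int, [/\ l = 2 ^+ (a - 1 - be) * s, odd `|s|%N & (r %| q * s)%Z].
  move=> lL l_neq0; apply/dyadic_half_oddP => //; rewrite -eq_R -eq_b.
  exact/(half_integer_frac K _ R_neq0)/half_digits.
have [l lL l_neq0] : exists2 l, l \in L & l != 0.
  apply: contrapT => L_sub0; move: sum1; rewrite big1_seq.
    by move/eqP; rewrite eq_sym oner_eq0.
  by move=> l /andP[l_neq0 lL]; case: L_sub0; exists l.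
have [be_lt_a _] := dyadicL l lL l_neq0.
exists a, r, be, q; split; last by move=> k kL k_neq0; have [] := dyadicL k kL k_neq0.
  by split=> //; move: be_lt_a; clear; lia.
by split=> //; split=> //; move: be_lt_a; clear; lia.
Qed.

Hypotheses (uniqL : uniq L) (L0 : 0 \in L) (alpha0 : alpha 0 = 1).

Lemma sum_weights (f : int -> K) :
  \sum_(l <- L) sqnormc (alpha l) * f l =
  f 0 + \sum_(l <- L | l != 0) sqnormc (alpha l) * f l.
Proof. by rewrite (bigD1_seq 0) //= alpha0 sqnormc1 mul1r. Qed.

Lemma Mentry_mulJ (l c d : int) :
  Mentry R alpha l c * conjc (Mentry R alpha l d) =
  (2^-1 * sqnormc (alpha l))%:C%C * ephase ((l * (c - d))%:~R / R%:~R).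
Proof.
rewrite /Mentry !conjcM conjc_real.
rewrite mulrBr intrB mulrBl ephaseD ephaseN [(_ * sqnormc _)%:C%C]rmorphM /= -mulcJ.
by rewrite -(mul_sqrtVC (ler0n K 2)); ring.
Qed.

Lemma orthonormal_columns_gramP :
  orthonormal_columns R b L alpha <->
  \sum_(l <- L | l != 0) sqnormc (alpha l) = 1 /\
  \sum_(l <- L) (sqnormc (alpha l))%:C%C * ephase ((l * b)%:~R / R%:~R) = 0.
Proof.
pose gram (x : int) : K[i] :=
  \sum_(l <- L) (sqnormc (alpha l))%:C%C * ephase ((l * x)%:~R / R%:~R).
have gramE c d : \sum_(l <- L) Mentry R alpha l c * conjc (Mentry R alpha l d) =
    2^-1 * gram (c - d).
  rewrite mulr_sumr; apply: eq_bigr => l _.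
  by rewrite Mentry_mulJ rmorphM fmorphV rmorph_nat mulrA.
have gramN x : gram (- x) = conjc (gram x).
  rewrite /gram rmorph_sum; apply: eq_bigr => l _.
  by rewrite [RHS]conjcM conjc_real mulrN rmorphN mulNr ephaseN.
have gram0 : gram 0 = (1 + \sum_(l <- L | l != 0) sqnormc (alpha l))%:C%C.
  under eq_bigr do rewrite -[sqnormc _]mulr1.
  rewrite -(sum_weights (fun=> 1)) rmorph_sum; apply: eq_bigr => l _.
  by rewrite !mulr0 mul0r ephase0 !mulr1.
have gram0_eq1 : 2^-1 * gram 0 = 1 <-> \sum_(l <- L | l != 0) sqnormc (alpha l) = 1.
  have half_two : 2^-1 = (2^-1)%:C%C :> K[i] by rewrite fmorphV rmorph_nat.
  rewrite gram0 half_two -rmorphM -(rmorph1 (real_complex K)).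
  split=> [/complexI|->]; first by lra.
  by congr (_%:C%C); field.
rewrite -/(gram b); split=> [ortho|[/gram0_eq1 diag gram_b] c d].
  split; first by apply/gram0_eq1; rewrite -(subrr 0) -gramE ortho ?eqxx ?inE ?eqxx.
  have := ortho b 0; rewrite !inE eqxx orbT gramE subr0 (negbTE b_neq0) => /(_ isT isT)/eqP.
  by rewrite mulf_eq0 invr_eq0 pnatr_eq0 => /eqP.
rewrite !inE gramE => /orP[]/eqP-> /orP[]/eqP->; rewrite ?subrr ?subr0 ?sub0r ?diag ?eqxx //.
  by rewrite gramN gram_b conjc0 mulr0 eq_sym (negbTE b_neq0).
by rewrite gram_b mulr0 (negbTE b_neq0).
Qed.

Hypothesis alpha_neq0 : {in L, forall l, alpha l != 0}.

Lemma orthonormal_columnsP :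
  orthonormal_columns R b L alpha <->
  half_integer_digits K R b L /\ \sum_(l <- L | l != 0) sqnormc (alpha l) = 1.
Proof.
rewrite orthonormal_columns_gramP; split=> -[]; last first.
  move=> half_digits sum1; split=> //; rewrite (bigD1_seq 0) //=.
  have -> : \sum_(l <- L | l != 0) (sqnormc (alpha l))%:C%C * ephase ((l * b)%:~R / R%:~R) =
      - (\sum_(l <- L | l != 0) sqnormc (alpha l))%:C%C.
    rewrite rmorph_sum -sumrN big_seq_cond [RHS]big_seq_cond.
    apply: eq_bigr => l /andP[lL l_neq0].
    by rewrite (ephase_half_integer (half_digits l lL l_neq0)) mulrN1.
  by rewrite alpha0 sqnormc1 mul0r mul0r ephase0 mulr1 sum1 subrr.
(* The weights of the nonzero digits sum to 1, so the real part of the vanishing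
   sum forces every cosine to be -1. *)
move=> sum1 /(congr1 (@complex.Re K)) /=; rewrite raddf_sum /=.
under eq_bigr do rewrite mul0r subr0.
rewrite sum_weights mul0r mul0r mulr0 cos0 -{1}sum1 -big_split /= => /eqP.
under eq_bigr do rewrite -{1}[sqnormc _]mulr1 -mulrDr.
rewrite psumr_eq0 => [/allP cosN1|l _]; last first.
  by rewrite mulr_ge0 ?sqr_ge0 // -lerBlDl sub0r cos_geN1.
split=> // l lL l_neq0; have := cosN1 l lL; rewrite l_neq0 /=.
rewrite mulf_eq0 sqnormc_eq0 (negbTE (alpha_neq0 lL)) addrC addr_eq0 => /eqP.
exact: (cos2pi_eqN1P _).1.
Qed.

End OrthonormalColumns.

(** * Square-integrable functions *)

Section RealIntegrable.
Context d (T : measurableType d) (K : realType) (mu : {measure set T -> \bar K}).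
Implicit Types f g : T -> K.

Definition rintegrable f := mu.-integrable setT (EFin \o f).

Lemma rintegrable_measurable f : rintegrable f -> measurable_fun setT f.
Proof. by move=> /measurable_int /measurable_EFinP. Qed.

Lemma rintegrable_le f g : measurable_fun setT f -> rintegrable g ->
  (forall x, `|f x| <= g x) -> rintegrable f.
Proof.
move=> mf ig fg; apply: le_integrable ig => //; first exact/measurable_EFinP.
by move=> x _ /=; rewrite lee_fin; apply: le_trans (fg x) (ler_norm _).
Qed.

Lemma rintegrableD f g : rintegrable f -> rintegrable g ->
  rintegrable (fun x => f x + g x).
Proof. by move=> int_f int_g; apply: eq_integrable (integrableD _ int_f int_g). Qed.

Lemma rintegrableZ (r : K) f : rintegrable f -> rintegrable (fun x => r * f x).
Proof. by move=> int_f; apply: eq_integrable (integrableZl _ r int_f). Qed.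

Lemma rintegrable_sum (I : eqType) (s : seq I) (F : I -> T -> K) :
  {in s, forall i, rintegrable (F i)} -> rintegrable (fun x => \sum_(i <- s) F i x).
Proof.
move=> int_F; apply: (@eq_integrable _ _ _ _ _ measurableT
    (fun x => (\sum_(i <- s | i \in s) (F i x)%:E)%E)).
  by move=> x _; rewrite sumEFin /= -big_seq.
by apply: integrable_sum => // i; exact: int_F.
Qed.

Lemma Rintegral_sum (I : eqType) (s : seq I) (F : I -> T -> K) :
    {in s, forall i, rintegrable (F i)} ->
  \int[mu]_x (\sum_(i <- s) F i x) = \sum_(i <- s) \int[mu]_x F i x.
Proof.
elim: s => [|i s IHs] int_F.
  by under eq_Rintegral do rewrite big_nil; rewrite big_nil /Rintegral integral0.
have int_Fs : {in s, forall j, rintegrable (F j)}.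
  by move=> j js; apply: int_F; rewrite inE js orbT.
under eq_Rintegral do rewrite big_cons.
rewrite big_cons -IHs // -RintegralD //; last exact: rintegrable_sum.
by apply: int_F; rewrite inE eqxx.
Qed.

Lemma Rintegral_dominated_cvg0 (f_ : nat -> T -> K) g :
    (forall n, measurable_fun setT (f_ n)) -> (forall x, f_ n x @[n --> \oo] --> (0 : K)) ->
    rintegrable g -> (forall n x, `|f_ n x| <= g x) ->
  \int[mu]_x f_ n x @[n --> \oo] --> (0 : K).
Proof.
move=> mf f_cvg0 int_g f_le_g.
have int_cvg0 : (\int[mu]_x (f_ n x)%:E)%E @[n --> \oo] --> (\int[mu]_x (0 : K)%:E)%E.
  apply: (@dominated_cvg _ _ _ mu setT measurableT
    (fun n x => (f_ n x)%:E) _ (EFin \o g)) => //.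
  - by move=> n; exact/measurable_EFinP.
  - by move=> x _; apply: cvg_EFin; [near=> n|exact: f_cvg0].
  - by move=> n x _ /=; rewrite lee_fin.
by rewrite integral0 in int_cvg0; have /fine_cvgP[] := int_cvg0.
Unshelve. all: by end_near.
Qed.

End RealIntegrable.

Section ProbabilityIntegral.
Context d (T : measurableType d) (K : realType) (mu : probability T K).
Implicit Types f : T -> K.

Lemma rintegrable_cst (r : K) : rintegrable mu (cst r).
Proof. exact: finite_measure_integrable_cst. Qed.

Lemma Rintegral_cst_prob (r : K) : \int[mu]_x r = r.
Proof. by rewrite /Rintegral integral_cst //= probability_setT mule1. Qed.

Lemma sqr_Rintegral_le f : rintegrable mu f -> rintegrable mu (fun x => f x ^+ 2) ->
  (\int[mu]_x f x) ^+ 2 <= \int[mu]_x (f x ^+ 2).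
Proof.
move=> int_f int_f2; set m := \int[mu]_x f x.
have int_affine : rintegrable mu (fun x => -2 * m * f x + m ^+ 2).
  by apply: rintegrableD (rintegrable_cst _); exact: rintegrableZ.
suff variance_eq : \int[mu]_x (f x - m) ^+ 2 = \int[mu]_x (f x ^+ 2) - m ^+ 2.
  by rewrite -subr_ge0 -variance_eq Rintegral_ge0 // => x _; exact: sqr_ge0.
transitivity (\int[mu]_x (f x ^+ 2 + (-2 * m * f x + m ^+ 2))).
  by apply: eq_Rintegral => x _; ring.
rewrite RintegralD // RintegralD //; [|exact: rintegrableZ|exact: rintegrable_cst].
by rewrite RintegralZl // Rintegral_cst_prob -/m; ring.
Qed.

End ProbabilityIntegral.

Section ComplexMeasurable.
Context d (T : measurableType d) (K : realType).
Implicit Types u v : T -> K[i].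

Definition cmeasurable v :=
  measurable_fun setT (fun x => complex.Re (v x)) /\
  measurable_fun setT (fun x => complex.Im (v x)).

Lemma cmeasurable_cst (c : K[i]) : cmeasurable (fun=> c).
Proof. by split; exact: measurable_cst. Qed.

Lemma cmeasurable_real (f : T -> K) :
  measurable_fun setT f -> cmeasurable (fun x => (f x)%:C%C).
Proof. by split=> //; exact: measurable_cst. Qed.

Lemma cmeasurableD u v : cmeasurable u -> cmeasurable v ->
  cmeasurable (fun x => u x + v x).
Proof.
move=> [ur ui] [vr vi]; split.
- by apply: eq_measurable_fun (measurable_funD ur vr) => x _ /=; case: (u x) (v x) => ? ? [].
- by apply: eq_measurable_fun (measurable_funD ui vi) => x _ /=; case: (u x) (v x) => ? ? [].
Qed.

Lemma cmeasurableM u v : cmeasurable u -> cmeasurable v ->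
  cmeasurable (fun x => u x * v x).
Proof.
move=> [ur ui] [vr vi]; split.
- apply: eq_measurable_fun (measurable_funB (measurable_funM ur vr) (measurable_funM ui vi)).
  by move=> x _ /=; case: (u x) (v x) => ? ? [].
- apply: eq_measurable_fun (measurable_funD (measurable_funM ur vi) (measurable_funM ui vr)).
  by move=> x _ /=; case: (u x) (v x) => ? ? [].
Qed.

Lemma cmeasurableJ v : cmeasurable v -> cmeasurable (fun x => conjc (v x)).
Proof.
move=> [vr vi]; split; first by apply: eq_measurable_fun vr => x _ /=; case: (v x).
by apply: eq_measurable_fun (measurable_funN vi) => x _ /=; case: (v x).
Qed.

Lemma measurable_sqnormc v : cmeasurable v -> measurable_fun setT (fun x => sqnormc (v x)).
Proof.
move=> [vr vi]; under eq_fun do rewrite sqnormcE.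
by apply: measurable_funD; exact: measurable_funX.
Qed.

End ComplexMeasurable.

Lemma cmeasurable_comp d d' (T : measurableType d) (T' : measurableType d') (K : realType)
    (v : T' -> K[i]) (phi : T -> T') :
  measurable_fun setT phi -> cmeasurable v -> cmeasurable (fun x => v (phi x)).
Proof.
move=> mphi [vr vi]; split; first exact: (measurableT_comp vr mphi).
exact: (measurableT_comp vi mphi).
Qed.

Section SquareIntegrable.
Context {K : realType} (mu : probability K K).
Implicit Types (c : K[i]) (u v : K -> K[i]).

Definition sqnormL2 v : K := \int[mu]_x sqnormc (v x).

Lemma inL2P v :
  inL2 mu v <-> cmeasurable v /\ rintegrable mu (fun x => sqnormc (v x)).
Proof. by split=> [[]|[[]]]. Qed.

Lemma inL2_integrable v : inL2 mu v -> rintegrable mu (fun x => sqnormc (v x)).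
Proof. by case/inL2P. Qed.

Lemma inL2_le u (g : K -> K) : cmeasurable u -> rintegrable mu g ->
  (forall x, sqnormc (u x) <= g x) -> inL2 mu u.
Proof.
move=> meas_u int_g le_ug; apply/inL2P; split=> //.
apply: rintegrable_le int_g _ => [|x]; first exact: measurable_sqnormc.
by rewrite ger0_norm ?sqr_ge0.
Qed.

Lemma inL2_bounded (B : K) v : cmeasurable v -> (forall x, sqnormc (v x) <= B) -> inL2 mu v.
Proof. by move=> meas_v; apply: inL2_le => //; exact: rintegrable_cst. Qed.

Lemma inL2_mul_bounded (B : K) u v : cmeasurable u -> (forall x, sqnormc (u x) <= B) ->
  inL2 mu v -> inL2 mu (fun x => u x * v x).
Proof.
move=> meas_u uB /inL2P[meas_v int_v]; apply: inL2_le (rintegrableZ B int_v) _.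
  exact: cmeasurableM.
by move=> x; rewrite sqnormcM ler_wpM2r ?sqr_ge0.
Qed.

Lemma inL2Z c v : inL2 mu v -> inL2 mu (fun x => c * v x).
Proof. by apply: (@inL2_mul_bounded (sqnormc c)) => //; exact: cmeasurable_cst. Qed.

Lemma inL2N v : inL2 mu v -> inL2 mu (fun x => - v x).
Proof. by move=> /(inL2Z (-1)); under eq_fun do rewrite mulN1r. Qed.

Lemma inL2D u v : inL2 mu u -> inL2 mu v -> inL2 mu (fun x => u x + v x).
Proof.
move=> /inL2P[meas_u int_u] /inL2P[meas_v int_v].
apply: inL2_le (rintegrableD (rintegrableZ 2 int_u) (rintegrableZ 2 int_v)) _.
  exact: cmeasurableD.
by move=> x; exact: sqnormcD_le.
Qed.

Lemma inL2B u v : inL2 mu u -> inL2 mu v -> inL2 mu (fun x => u x - v x).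
Proof. by move=> L2u /inL2N; exact: inL2D. Qed.

Lemma inL2_sum (I : eqType) (s : seq I) (F : I -> K -> K[i]) :
  {in s, forall i, inL2 mu (F i)} -> inL2 mu (fun x => \sum_(i <- s) F i x).
Proof.
elim: s => [|i s IHs] L2F; under eq_fun do rewrite ?big_nil ?big_cons.
  by apply: (@inL2_bounded 0) => [|x]; [exact: cmeasurable_cst|rewrite sqnormcR expr0n].
apply: inL2D; first by apply: L2F; rewrite inE eqxx.
by apply: IHs => j js; apply: L2F; rewrite inE js orbT.
Qed.

Lemma inL2_Re_Im v : inL2 mu v <->
  inL2 mu (fun x => (complex.Re (v x))%:C%C) /\ inL2 mu (fun x => (complex.Im (v x))%:C%C).
Proof.
split=> [/inL2P[[mRe mIm] int_v]|[L2Re /(inL2Z 'i%C) L2Im]].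
  split; apply: inL2_le int_v _ => [|x]; try exact: cmeasurable_real;
    by rewrite sqnormcR sqnormcE ?lerDl ?lerDr sqr_ge0.
by have := inL2D L2Re L2Im; under eq_fun do rewrite -complexE.
Qed.

Lemma inL2_real_integrable (f : K -> K) : inL2 mu (fun x => (f x)%:C%C) ->
  rintegrable mu f /\ rintegrable mu (fun x => f x ^+ 2).
Proof.
move=> /inL2P[[mf _]]; under [X in rintegrable _ X]eq_fun do rewrite sqnormcR.
move=> int_f2; split=> //.
apply: rintegrable_le mf (rintegrableD (rintegrable_cst mu 1) int_f2) _ => x /=.
by rewrite ler_norml; have := sqr_ge0 (f x - 1); have := sqr_ge0 (f x + 1); nra.
Qed.

Lemma inL2_Re v : inL2 mu v -> rintegrable mu (fun x => complex.Re (v x)).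
Proof. by move=> /inL2_Re_Im[/inL2_real_integrable[]]. Qed.

Lemma inL2_Im v : inL2 mu v -> rintegrable mu (fun x => complex.Im (v x)).
Proof. by move=> /inL2_Re_Im[_ /inL2_real_integrable[]]. Qed.

Lemma cintegralE v :
  cintegral mu v = Complex (\int[mu]_x complex.Re (v x)) (\int[mu]_x complex.Im (v x)).
Proof. by []. Qed.

Lemma cintegralD u v : inL2 mu u -> inL2 mu v ->
  cintegral mu (fun x => u x + v x) = cintegral mu u + cintegral mu v.
Proof.
move=> L2u L2v; rewrite !cintegralE; simpc; congr Complex.
  rewrite -RintegralD //; [|exact: inL2_Re|exact: inL2_Re].
  by apply: eq_Rintegral => x _ /=; case: (u x) (v x) => ? ? [].
rewrite -RintegralD //; [|exact: inL2_Im|exact: inL2_Im].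
by apply: eq_Rintegral => x _ /=; case: (u x) (v x) => ? ? [].
Qed.

Lemma cintegralZ c v : inL2 mu v ->
  cintegral mu (fun x => c * v x) = c * cintegral mu v.
Proof.
move=> L2v; have [int_Re int_Im] := (inL2_Re L2v, inL2_Im L2v).
rewrite !cintegralE; case: c => a d; simpc; congr Complex.
  rewrite -!RintegralZl // -RintegralB //; [|exact: rintegrableZ|exact: rintegrableZ].
  by apply: eq_Rintegral => x _; case: (v x).
rewrite -!RintegralZl // -RintegralD //; [|exact: rintegrableZ|exact: rintegrableZ].
by apply: eq_Rintegral => x _; case: (v x).
Qed.

Lemma cintegralB u v : inL2 mu u -> inL2 mu v ->
  cintegral mu (fun x => u x - v x) = cintegral mu u - cintegral mu v.
Proof.
move=> L2u L2v; under eq_fun do rewrite -mulN1r.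
by rewrite cintegralD ?cintegralZ ?mulN1r //; exact: inL2Z.
Qed.

Lemma sqnormc_cintegral_le v : inL2 mu v -> sqnormc (cintegral mu v) <= sqnormL2 v.
Proof.
move=> /inL2_Re_Im[/inL2_real_integrable[int_Re int_Re2]].
move=> /inL2_real_integrable[int_Im int_Im2].
rewrite /sqnormL2; under [leRHS]eq_Rintegral do rewrite sqnormcE.
by rewrite cintegralE sqnormcE RintegralD // lerD // sqr_Rintegral_le.
Qed.

Lemma sqnormL2Z c v : inL2 mu v -> sqnormL2 (fun x => c * v x) = sqnormc c * sqnormL2 v.
Proof.
move=> /inL2_integrable int_v; rewrite /sqnormL2 -RintegralZl //.
by apply: eq_Rintegral => x _; rewrite sqnormcM.
Qed.

Lemma sqnormL2_parallelogram u v : inL2 mu u -> inL2 mu v ->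
  sqnormL2 (fun x => u x + v x) + sqnormL2 (fun x => u x - v x) =
  2 * sqnormL2 u + 2 * sqnormL2 v.
Proof.
move=> L2u L2v; have int_D := inL2_integrable (inL2D L2u L2v).
have int_B := inL2_integrable (inL2B L2u L2v).
move: (inL2_integrable L2u) (inL2_integrable L2v) => int_u int_v.
rewrite /sqnormL2 -RintegralD // -!RintegralZl // -RintegralD //; try exact: rintegrableZ.
by apply: eq_Rintegral => x _; exact: sqnormc_parallelogram.
Qed.

End SquareIntegrable.

Section Exponential.
Context {K : realType} (mu : probability K K).
Implicit Types t x : K.

Definition expt t x : K[i] := ephase (t * x).

Lemma exptD s t x : expt (s + t) x = expt s x * expt t x.
Proof. by rewrite /expt mulrDl ephaseD. Qed.

Lemma expt0 : expt 0 = fun=> 1.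
Proof. by apply/funext => x; rewrite /expt mul0r ephase0. Qed.

Lemma cmeasurable_expt t : cmeasurable (expt t).
Proof.
have mphase : measurable_fun setT (fun x : K => 2 * pi * (t * x)).
  by apply: measurable_funM => //; apply: measurable_funM.
split; apply: measurableT_comp mphase; apply: continuous_measurable_fun.
  exact: continuous_cos.
exact: continuous_sin.
Qed.

Lemma inL2_expt t : inL2 mu (expt t).
Proof.
by apply: (@inL2_bounded _ _ 1) => [|x]; [exact: cmeasurable_expt|rewrite sqnormc_ephase].
Qed.

Lemma sqnormL2_expt t : sqnormL2 mu (expt t) = 1.
Proof.
rewrite -[RHS](Rintegral_cst_prob mu 1).
by apply: eq_Rintegral => x _; rewrite sqnormc_ephase.
Qed.

Lemma continuous_Rintegral_scale (B : K) (f : K -> K) :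
  continuous f -> (forall x, `|f x| <= B) -> continuous (fun t => \int[mu]_x f (t * x)).
Proof.
move=> cf f_le t.
have mf s : measurable_fun setT (fun x => f (s * x)).
  by apply: measurableT_comp; [exact: continuous_measurable_fun|exact: measurable_funM].
apply: (@continuity_under_integral _ _ _ mu (fun t x => f (t * x)) setT
  measurableT (t - 1) (t + 1) _ _ (cst B)).
- by move=> s _; apply: rintegrable_le (rintegrable_cst mu B) _ => //; exact: mf.
- by apply: aeW => x _ s _; apply: continuous_comp; [exact: cvgMr_tmp|exact: cf].
- exact: rintegrable_cst.
- by move=> s _; apply: aeW => x _; exact: f_le.
- by rewrite inE /= in_itv /=; apply/andP; split; lra.
Qed.

Lemma continuous_sqnormc_cintegral_expt :
  continuous (fun t => sqnormc (cintegral mu (expt t))).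
Proof.
have continuous_trig (f : K -> K) : continuous f -> (forall x, `|f x| <= 1) ->
    continuous (fun t => \int[mu]_x f (2 * pi * (t * x))).
  move=> cf f_le1; apply: (continuous_Rintegral_scale (f := fun y => f (2 * pi * y))) => [y|y].
    by apply: continuous_comp; [exact: cvgMl_tmp|exact: cf].
  exact: f_le1.
under eq_fun do rewrite sqnormcE !expr2 /=.
move=> t; apply: cvgD; apply: cvgM; apply: continuous_trig;
  first [exact: continuous_cos | exact: continuous_sin | exact: cos_max | exact: sin_max].
Qed.

End Exponential.

(** * Density of the exponentials *)

Section NewtonSign.
Context {K : realType}.
Implicit Types y z : K.

(* The iterates converge pointwise to the sign on [-1, 1], so polynomials in sines
   converge boundedly to indicators of half-lines. *)
Definition newton_sign y : K := (3 * y - y ^+ 3) / 2.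

Lemma iter_newton_signN n y : iter n newton_sign (- y) = - iter n newton_sign y.
Proof. by elim: n => //= n ->; rewrite /newton_sign; ring. Qed.

Lemma iter_newton_sign_itv n y : 0 <= y <= 1 ->
  y <= iter n newton_sign y <= 1 /\
  1 - iter n newton_sign y <= (1 - y / 2) ^+ n.
Proof.
move=> /andP[y_ge0 y_le1]; elim: n => [|n [/andP[lo hi] IHn]].
  by rewrite /= lexx y_le1 expr0; split=> //; lra.
rewrite iterS exprSr; move: lo hi IHn; set z := iter n _ y => y_le_z z_le1 IHn.
have z_ge0 : 0 <= z := le_trans y_ge0 y_le_z.
have contraction : 1 - newton_sign z = (1 - z) * ((1 - z) * (2 + z) / 2).
  by rewrite /newton_sign; field.
have factor_ge0 : 0 <= (1 - z) * (2 + z) / 2.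
  by rewrite divr_ge0 // mulr_ge0 ?subr_ge0 //; lra.
have z_le : z <= newton_sign z.
  have -> : newton_sign z = z + z * (1 - z) * (1 + z) / 2 by rewrite /newton_sign; field.
  by rewrite lerDl divr_ge0 // !mulr_ge0 ?subr_ge0 ?addr_ge0.
split.
  by rewrite (le_trans y_le_z z_le) -subr_ge0 contraction mulr_ge0 ?subr_ge0.
rewrite contraction ler_pM ?subr_ge0 //.
have -> : (1 - z) * (2 + z) / 2 = 1 - z / 2 - z * z / 2 by field.
by have := mulr_ge0 z_ge0 z_ge0; lra.
Qed.

Lemma norm_iter_newton_sign_le1 n y : `|y| <= 1 -> `|iter n newton_sign y| <= 1.
Proof.
have nonneg_case z : 0 <= z <= 1 -> `|iter n newton_sign z| <= 1.
  move=> /[dup] /andP[z_ge0 _] /(iter_newton_sign_itv n)[/andP[lo hi] _].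
  by rewrite ger0_norm // (le_trans z_ge0 lo).
have [y_ge0|y_lt0] := leP 0 y => norm_y.
  by apply: nonneg_case; rewrite y_ge0 -(ger0_norm y_ge0).
rewrite -[y]opprK iter_newton_signN normrN; apply: nonneg_case.
by rewrite oppr_ge0 (ltW y_lt0) -ltr0_norm.
Qed.

Lemma cvg_iter_newton_sign y : `|y| <= 1 ->
  iter n newton_sign y @[n --> \oo] --> Num.sg y.
Proof.
have cvg_pos z : 0 < z -> z <= 1 -> iter n newton_sign z @[n --> \oo] --> (1 : K).
  move=> z_gt0 z_le1; have bounds n := iter_newton_sign_itv n (y := z).
  apply/subr_cvg0; apply/cvgNP; rewrite oppr0.
  have ratio_lt1 : `|1 - z / 2| < 1 by rewrite ger0_norm; lra.
  apply: (squeeze_cvgr _ (cvg_cst 0) (cvg_expr ratio_lt1)); near=> n => /=.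
  by have [|/andP[_ ?] ?] := bounds n; [rewrite ltW|rewrite opprB subr_ge0; apply/andP].
have [y_lt0|y_gt0|->] := ltrgtP y 0.
- rewrite ltr0_norm // ltr0_sg // => y_geN1.
  have iterE n : iter n newton_sign y = - iter n newton_sign (- y).
    by rewrite iter_newton_signN opprK.
  under eq_fun do rewrite iterE.
  by apply: cvgN; apply: cvg_pos => //; rewrite oppr_gt0.
- by rewrite gtr0_norm // gtr0_sg //; exact: cvg_pos.
- move=> _; rewrite sgr0.
  have fix0 n : iter n newton_sign (0 : K) = 0.
    by elim: n => //= n ->; rewrite /newton_sign; ring.
  by under eq_fun do rewrite fix0; exact: cvg_cst.
Unshelve. all: by end_near.
Qed.

Lemma sgr_indic y : (Num.sg y * Num.sg y + Num.sg y) / 2 = (0 < y)%R%:R.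
Proof.
have [y_lt0|y_gt0|->] := ltrgtP y 0.
- by rewrite ltr0_sg // mulrNN mulr1 addrN mul0r.
- by rewrite gtr0_sg // mulr1 divff.
- by rewrite sgr0 mulr0 addr0 mul0r.
Qed.

End NewtonSign.

Lemma cvg_sum_indic_bigcup T (K : realType) (F : (set T)^nat) (x : T) : trivIset setT F ->
  \sum_(i < n) \1_(F i) x @[n --> \oo] --> (\1_(\bigcup_n F n) x : K).
Proof.
move=> trivF; under eq_fun do rewrite -(big_mkord xpredT (fun i => \1_(F i) x)).
apply: (@fine_cvg _ _ _ _ (fun n => (\sum_(0 <= i < n) \1_(F i) x)%:E)).
rewrite indic_bigcup //; under eq_fun do rewrite -sumEFin.
by apply: is_cvg_nneseries => i _ _; rewrite lee_fin.
Qed.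

Lemma sum_indic_le1 T (K : realType) (F : (set T)^nat) n (x : T) : trivIset setT F ->
  \sum_(i < n) \1_(F i) x <= 1 :> K.
Proof.
move=> trivF; apply: (@le_trans _ _ (\1_(\bigcup_n F n) x)); last first.
  by rewrite indicE; case: (_ \in _).
have cvgF := @cvg_sum_indic_bigcup T K F x trivF.
rewrite -(cvg_lim _ cvgF) //; apply: nondecreasing_cvgn_le; last exact: (cvgP _ cvgF).
apply/nondecreasing_seqP => m; rewrite big_ord_recr /= lerDl.
by rewrite indicE; case: (_ \in _).
Qed.

Record closed_subspace (K : realType) (mu : probability K K)
    (P : (K -> K[i]) -> Prop) : Prop := ClosedSubspace {
  closed_subspace_inL2 : forall v, P v -> inL2 mu v;
  closed_subspaceD : forall u v, P u -> P v -> P (fun x => u x + v x);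
  closed_subspaceZ : forall c v, P v -> P (fun x => c * v x);
  closed_subspace_lim : forall v, inL2 mu v ->
    (forall e, 0 < e -> exists u, P u /\ sqnormL2 mu (fun x => v x - u x) < e) -> P v }.

Section RealIn.
Context {T : Type} {K : realType} (P : (T -> K[i]) -> Prop).
Implicit Types f g : T -> K.

Definition real_in f : Prop := P (fun x => (f x)%:C%C).

Lemma eq_real_in f g : f =1 g -> real_in f -> real_in g.
Proof. by move=> /funext ->. Qed.

Lemma real_inD f g : (forall u v, P u -> P v -> P (fun x => u x + v x)) ->
  real_in f -> real_in g -> real_in (fun x => f x + g x).
Proof. by move=> PD Pf Pg; rewrite /real_in; under eq_fun do rewrite rmorphD; exact: PD. Qed.

Lemma real_inM f g : (forall u v, P u -> P v -> P (fun x => u x * v x)) ->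
  real_in f -> real_in g -> real_in (fun x => f x * g x).
Proof. by move=> PM Pf Pg; rewrite /real_in; under eq_fun do rewrite rmorphM; exact: PM. Qed.

Lemma real_inZ (r : K) f : (forall c v, P v -> P (fun x => c * v x)) ->
  real_in f -> real_in (fun x => r * f x).
Proof. by move=> PZ Pf; rewrite /real_in; under eq_fun do rewrite rmorphM; exact: PZ. Qed.

End RealIn.

Section ClosedSubspace.
Context {K : realType} (mu : probability K K) (P : (K -> K[i]) -> Prop).
Hypothesis subspaceP : closed_subspace mu P.
Implicit Types (f g : K -> K) (v : K -> K[i]).
Local Notation real_in := (real_in P).

Let PD := closed_subspaceD subspaceP.
Let PZ := closed_subspaceZ subspaceP.

Lemma real_inB f g : real_in f -> real_in g -> real_in (fun x => f x - g x).
Proof.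
move=> Pf /(real_inZ (-1) PZ) /(real_inD PD Pf).
by apply: eq_real_in => x; rewrite mulN1r.
Qed.

Lemma real_in_measurable f : real_in f -> measurable_fun setT f.
Proof. by move=> /(closed_subspace_inL2 subspaceP)[]. Qed.

Lemma real_in_dominated_cvg f (f_ : nat -> K -> K) g :
    inL2 mu (fun x => (f x)%:C%C) -> (forall n, real_in (f_ n)) ->
    (forall x, f_ n x @[n --> \oo] --> f x) ->
    rintegrable mu g -> (forall n x, (f x - f_ n x) ^+ 2 <= g x) ->
  real_in f.
Proof.
move=> L2f Pf_ f_cvg int_g dist_le; apply: (closed_subspace_lim subspaceP) => // e e_gt0.
have dist_cvg0 : \int[mu]_x (f x - f_ n x) ^+ 2 @[n --> \oo] --> (0 : K).
  apply: (Rintegral_dominated_cvg0 _ _ int_g) => [n|x|n x]; last by rewrite ger0_norm ?sqr_ge0.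
    apply: measurable_funX; apply: measurable_funB; last exact: real_in_measurable.
    by case: L2f.
  have dist0 : (f x - f_ n x) @[n --> \oo] --> (0 : K).
    by rewrite -(subrr (f x)); apply: cvgB; [exact: cvg_cst|exact: f_cvg].
  by rewrite -(mul0r 0); under eq_fun do rewrite expr2; exact: cvgM.
have [n _ /(_ n (leqnn n)) /= dist_lt_e] := cvgr_lt _ dist_cvg0 _ e_gt0.
exists (fun x => (f_ n x)%:C%C); split; first exact: Pf_.
rewrite /sqnormL2; under eq_Rintegral do rewrite -rmorphB sqnormcR.
exact: dist_lt_e.
Qed.

Lemma real_in_bounded_cvg (B : K) f (f_ : nat -> K -> K) :
    (forall n, real_in (f_ n)) -> (forall n x, `|f_ n x| <= B) ->
    (forall x, f_ n x @[n --> \oo] --> f x) ->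
  real_in f.
Proof.
move=> Pf_ f_le f_cvg.
have sqr_le y z : `|y| <= z -> y ^+ 2 <= z ^+ 2 :> K.
  by move=> le_yz; rewrite -real_normK ?num_real // ler_sqr ?nnegrE // (le_trans _ le_yz).
have flim_le x : `|f x| <= B.
  apply: (closed_cvg (fun y => `|y| <= B) _ _ _ (f_cvg x)); last by near=> n.
  apply: (@closed_comp _ _ (fun y : K => `|y|) [set y | y <= B]); last exact: closed_le.
  by move=> y _; exact: norm_continuous.
apply: (@real_in_dominated_cvg f f_ (cst ((2 * B) ^+ 2))) => // [||n x].
- apply: (@inL2_bounded _ _ (B ^+ 2)) => [|x]; last by rewrite sqnormcR sqr_le.
  apply: cmeasurable_real; apply: (measurable_fun_cvg (h := f_)) => [n|x _].
    exact: real_in_measurable.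
  exact: f_cvg.
- exact: rintegrable_cst.
- apply: sqr_le; apply: le_trans (ler_normB _ _) _.
  by have := f_le n x; have := flim_le x; lra.
Unshelve. all: by end_near.
Qed.

Hypothesis real_in1 : real_in (cst 1).

Lemma real_in_sum (I : Type) (s : seq I) (F : I -> K -> K) :
  (forall i, real_in (F i)) -> real_in (fun x => \sum_(i <- s) F i x).
Proof.
move=> PF; elim: s => [|i s IHs].
  by apply: eq_real_in (real_inZ 0 PZ real_in1) => x; rewrite big_nil mul0r.
by apply: eq_real_in (real_inD PD (PF i) IHs) => x; rewrite big_cons.
Qed.

Hypothesis real_in_halfline : forall a : K, real_in (\1_`]a, +oo[).

Lemma real_in_indic (A : set K) : measurable A -> real_in (\1_A).
Proof.
move=> mA; have genR := RGenOInfty.measurableE K.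
have : <<s @RGenOInfty.G K >> A by rewrite -[<<s _ >>]genR.
apply: (@dynkin_induction _ _ _ (fun A => real_in (\1_A)) genR) => {mA A}.
- move=> _ _ [x ->] [y ->]; exists (Num.max x y).
  by apply/seteqP; split=> z /=; rewrite !in_itv /= !andbT gt_max => /andP.
- by rewrite indicT.
- by move=> _ [x ->]; exact: real_in_halfline.
- move=> A _ PA; apply: eq_real_in (real_inB real_in1 PA) => x.
  by rewrite indicC indicE; case: (x \in A); rewrite ?subrr ?subr0.
move=> F _ trivF PF; apply: (@real_in_bounded_cvg 1 _ (fun n x => \sum_(i < n) \1_(F i) x)).
- by move=> n; exact: real_in_sum.
- by move=> n x; rewrite ger0_norm ?sum_indic_le1 // sumr_ge0.
- by move=> x; exact: cvg_sum_indic_bigcup.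
Qed.

Lemma real_in_nnsfun (f : {nnsfun K >-> K}) : real_in f.
Proof.
have : real_in (fun x => \sum_(y <- finmap.enum_fset (fset_set (range f)))
    y * \1_(f @^-1` [set y]) x).
  by apply: real_in_sum => y; apply: real_inZ PZ _; exact: real_in_indic.
by apply: eq_real_in => x; rewrite [RHS]fimfunE fsbig_finite //; exact: fimfunP.
Qed.

Lemma real_in_ge0 f :
  inL2 mu (fun x => (f x)%:C%C) -> (forall x, 0 <= f x) -> real_in f.
Proof.
move=> L2f f_ge0; have [mf _ _] := L2f.
have mEf : measurable_fun setT (EFin \o f) by exact/measurable_EFinP.
pose f_ := nnsfun_approx measurableT mEf.
have f_cvg x : f_ n x @[n --> \oo] --> f x.
  have := @cvg_nnsfun_approx _ _ _ _ measurableT _ mEf (fun x _ => f_ge0 x) x Logic.I.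
  by move/fine_cvgP => [].
have f_le n x : f_ n x <= f x.
  have /cvg_lim <- // := f_cvg x; apply: nondecreasing_cvgn_le; last exact: (cvgP _ (f_cvg x)).
  by move=> i j ij; exact/lefP/(nd_nnsfun_approx measurableT mEf ij).
apply: (real_in_dominated_cvg L2f _ f_cvg (inL2_real_integrable L2f).2) => [n|n x].
  exact: real_in_nnsfun.
by rewrite ler_sqr ?nnegrE ?subr_ge0 // lerBlDr lerDl fun_ge0.
Qed.

Lemma real_in_inL2 f : inL2 mu (fun x => (f x)%:C%C) -> real_in f.
Proof.
move=> L2f; have [mf _ _] := L2f; have int_f2 := (inL2_real_integrable L2f).2.
have real_in_le_norm g : measurable_fun setT g -> (forall x, 0 <= g x <= `|f x|) -> real_in g.
  move=> mg g_le; apply: real_in_ge0 => [|x]; last by have /andP[] := g_le x.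
  apply: inL2_le int_f2 _ => [|x]; first exact: cmeasurable_real.
  rewrite sqnormcR -[leRHS]real_normK ?num_real //.
  by have /andP[g_ge0 g_lef] := g_le x; rewrite ler_sqr ?nnegrE.
apply: (eq_real_in (f := fun x => f^\+ x - f^\- x)).
  by move=> x; rewrite -[in RHS](funrposBneg f).
apply: real_inB; apply: real_in_le_norm => [|x].
- exact: measurable_funrpos.
- by rewrite funrpos_ge0 /funrpos ge_max ler_norm normr_ge0.
- exact: measurable_funrneg.
- by rewrite funrneg_ge0 /funrneg ge_max -normrN ler_norm normr_ge0.
Qed.

Lemma closed_subspace_total v : inL2 mu v -> P v.
Proof.
move=> /inL2_Re_Im[/real_in_inL2 PRe /real_in_inL2 PIm].
rewrite (_ : v = (fun x => (complex.Re (v x))%:C%C + 'i%C * (complex.Im (v x))%:C%C)).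
  by apply: PD => //; exact: PZ.
by apply/funext => x; exact: complexE.
Qed.

End ClosedSubspace.

Section TrigonometricPolynomials.
Context {K : realType}.
Implicit Types (f : K -> K) (u v : K -> K[i]) (a s t : K).

Inductive trigpoly : (K -> K[i]) -> Prop :=
| trigpoly_expt t : trigpoly (expt t)
| trigpolyD u v : trigpoly u -> trigpoly v -> trigpoly (fun x => u x + v x)
| trigpolyZ c v : trigpoly v -> trigpoly (fun x => c * v x).

Lemma trigpolyM u v : trigpoly u -> trigpoly v -> trigpoly (fun x => u x * v x).
Proof.
move=> tu; elim: tu v => [t|u1 u2 _ IH1 _ IH2|c u1 _ IH1] v tv.
- elim: tv => [s|v1 v2 _ IH1 _ IH2|c v1 _ IH1].
  + by under eq_fun do rewrite -exptD; exact: trigpoly_expt.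
  + by under eq_fun do rewrite mulrDr; exact: trigpolyD.
  + by under eq_fun do rewrite mulrCA; exact: trigpolyZ.
- under eq_fun do rewrite mulrDl; apply: trigpolyD; [exact: IH1|exact: IH2].
- by under eq_fun do rewrite -mulrA; apply: trigpolyZ; exact: IH1.
Qed.

Lemma trigpoly_sin s a : real_in trigpoly (fun x => sin (2 * pi * (s * (x - a)))).
Proof.
rewrite /real_in (_ : (fun _ => _) = (fun x =>
    (Complex 0 (- 2^-1) * ephase (- (s * a))) * expt s x +
    (Complex 0 (2^-1) * ephase (s * a)) * expt (- s) x)).
  by apply: trigpolyD; apply: trigpolyZ; exact: trigpoly_expt.
apply/funext => x; rewrite /expt -!(mulrA (Complex 0 _)) -!ephaseD.
have -> : - (s * a) + s * x = s * (x - a) by ring.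
have -> : s * a + - s * x = - (s * (x - a)) by ring.
rewrite ephaseN /ephase; set c := cos _; set d := sin _.
by apply/eqP; rewrite eq_complex /=; apply/andP; split; apply/eqP; field.
Qed.

Lemma trigpoly_newton_sign n f :
  real_in trigpoly f -> real_in trigpoly (fun x => iter n newton_sign (f x)).
Proof.
move=> tf; elim: n => [//|n IHn] /=; set g := fun x => iter n _ _ in IHn.
rewrite (_ : (fun _ => _) = (fun x => (3 / 2) * g x + (- 2^-1) * (g x * (g x * g x)))).
  apply: real_inD trigpolyD _ _; apply: real_inZ trigpolyZ _ => //.
  by do 2 apply: real_inM trigpolyM _ _ => //.
by apply/funext => x; rewrite /newton_sign -/(g x); field.
Qed.

End TrigonometricPolynomials.

Lemma sin_scale_gt0 (K : realType) (N y : K) : 2 * `|y| < N ->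
  (0 < sin (2 * pi * (N^-1 * y))) = (0 < y).
Proof.
move=> y_lt; have N_gt0 : 0 < N by apply: le_lt_trans y_lt; rewrite mulr_ge0.
have sin_gt0 z : 0 < z -> 2 * z < N -> 0 < sin (2 * pi * (N^-1 * z)).
  move=> z_gt0 z_lt; apply: sin_gt0_pi.
  rewrite (_ : 2 * pi * (N^-1 * z) = 2 * z / N * pi); last by ring.
  have z_ratio : 0 < 2 * z / N < 1.
    by rewrite divr_gt0 ?mulr_gt0 //= ltr_pdivrMr // mul1r.
  by have := pi_gt0 K; nra.
have [y_lt0|y_gt0|->] := ltrgtP y 0.
- apply/negbTE; rewrite -leNgt -oppr_ge0 -sinN -!mulrN ltW // sin_gt0 ?oppr_gt0 //.
  by rewrite -(ltr0_norm y_lt0).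
- by rewrite sin_gt0 // -(gtr0_norm y_gt0).
- by rewrite !mulr0 sin0 ltxx.
Qed.

Section ExponentialsTotal.
Context {K : realType} (mu : probability K K) (P : (K -> K[i]) -> Prop).
Hypotheses (subspaceP : closed_subspace mu P) (P_expt : forall t, P (expt t)).

Lemma real_in_trigpoly (f : K -> K) : real_in trigpoly f -> real_in P f.
Proof.
have [_ PD PZ _] := subspaceP.
by rewrite /real_in; elim=> *; [exact: P_expt|exact: PD|exact: PZ].
Qed.

Lemma real_in_sin_gt0 (s a : K) :
  real_in P (fun x => (0 < sin (2 * pi * (s * (x - a))))%R%:R).
Proof.
pose q n x := iter n newton_sign (sin (2 * pi * (s * (x - a)))).
have q_le1 n x : `|q n x| <= 1 by exact/norm_iter_newton_sign_le1/sin_max.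
apply: (real_in_bounded_cvg subspaceP (B := 1)
  (f_ := fun n x => 2^-1 * (q n x * q n x + q n x))) => [n|n x|x].
- apply: real_in_trigpoly; apply: real_inZ trigpolyZ _.
  have tq : real_in trigpoly (q n).
    by apply: trigpoly_newton_sign; exact: trigpoly_sin.
  by apply: real_inD trigpolyD _ _ => //; exact: real_inM trigpolyM _ _.
- by have := q_le1 n x; rewrite !ler_norml; nra.
- rewrite -sgr_indic mulrC; have q_cvg := cvg_iter_newton_sign (sin_max _).
  by apply: cvgMl_tmp; apply: cvgD; [apply: cvgM|]; exact: q_cvg.
Qed.

(* For [n] large, [x - a] is less than half a period of the sine. *)
Lemma real_in_halfline (a : K) : real_in P (\1_`]a, +oo[).
Proof.
apply: (real_in_bounded_cvg subspaceP (B := 1)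
  (f_ := fun n x => (0 < sin (2 * pi * (n.+1%:R^-1 * (x - a))))%R%:R)) => [n|n x|x].
- exact: real_in_sin_gt0.
- by case: (_ < _); rewrite ?normr1 ?normr0.
apply: cvg_near_cst; near=> n.
rewrite sin_scale_gt0; last first.
  apply: (@le_lt_trans _ _ n%:R); last by rewrite ltr_nat.
  by near: n; exact: nbhs_infty_ger.
by rewrite indicE mem_setE in_itv /= andbT subr_gt0.
Unshelve. all: by end_near.
Qed.

Lemma exponentials_total v : inL2 mu v -> P v.
Proof.
apply: closed_subspace_total => //; last exact: real_in_halfline.
rewrite /real_in (_ : (fun _ => _) = expt 0); first exact: P_expt.
by rewrite expt0.
Qed.

End ExponentialsTotal.

(** * Maximum principle and invariant sets *)

Lemma closed_superlevel (T : topologicalType) (K : realType) (g : T -> K) (r : K) :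
  continuous g -> closed [set t | r <= g t].
Proof.
move=> cg; apply: (@closed_comp _ _ g [set y | r <= y]); last exact: closed_ge.
by move=> t _; exact: cg.
Qed.

Section MaximumPrinciple.
Context {T : topologicalType} {K : realType} (X : set T) (I : eqType) (s : seq I).
Variables (p : I -> T -> K) (f : I -> T -> T) (D : nat -> T -> K).
Hypotheses (compactX : compact X) (closedX : closed X) (X_neq0 : X !=set0).
Hypothesis f_in : forall i t, i \in s -> X t -> X (f i t).
Hypothesis p_ge0 : forall i t, i \in s -> 0 <= p i t.
Hypothesis sum_p : forall t, \sum_(i <- s) p i t = 1.
Hypothesis D_cont : forall k, continuous (D k).
Hypothesis D_ge0 : forall k t, 0 <= D k t.
Hypothesis D_decr : forall j k t, (j <= k)%N -> D k t <= D j t.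
Hypothesis D_rec : forall k t, D k.+1 t = \sum_(i <- s) p i t * D k (f i t).

Definition limit_max : K := inf (range (fun k => sup (D k @` X))).

(* The points of [X] where the decreasing limit of [D] attains its maximum. *)
Definition limit_maximizers : set T := [set t | X t /\ forall k, limit_max <= D k t].

Lemma has_sup_image k : has_sup (D k @` X).
Proof.
apply: compact_has_sup; first exact: image_nonempty.
by apply: continuous_compact => //; exact: continuous_subspaceT.
Qed.

Lemma le_sup_image k t : X t -> D k t <= sup (D k @` X).
Proof. by move=> Xt; apply: sup_upper_bound; [exact: has_sup_image|exists t]. Qed.

Lemma has_inf_sup_image : has_inf (range (fun k => sup (D k @` X))).
Proof.
have [x Xx] := X_neq0; split; first by exists (sup (D 0 @` X)), 0%N.
by exists 0 => _ [k _ <-]; exact: le_trans (D_ge0 k x) (le_sup_image k Xx).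
Qed.

Lemma limit_max_lt e : limit_max < e -> exists k, forall t, X t -> D k t < e.
Proof.
rewrite -subr_gt0 => /(inf_adherent)/(_ has_inf_sup_image)[_ [k _ <-]].
rewrite addrC subrK => sup_lt; exists k => t Xt.
by apply: le_lt_trans sup_lt; exact: le_sup_image.
Qed.

Lemma limit_max_attained k : exists2 t, X t & limit_max <= D k t.
Proof.
have [t /set_mem Xt t_max] :=
  compact_EVT_max X_neq0 compactX (continuous_subspaceT (@D_cont k)).
exists t => //; apply: (@le_trans _ _ (sup (D k @` X))).
  by apply: ge_inf; [exact: has_inf_sup_image.2|exists k].
apply: ge_sup; first exact: image_nonempty.
by move=> _ [u Xu <-]; apply: t_max; exact/mem_set.
Qed.

Lemma closed_limit_maximizers : closed limit_maximizers.
Proof.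
have -> : limit_maximizers = X `&` \bigcap_k [set t | limit_max <= D k t].
  by apply/seteqP; split=> t [Xt t_max]; split=> // k; [move=> _|]; exact: t_max.
by apply: closedI => //; apply: closed_bigI => k _; exact/closed_superlevel/D_cont.
Qed.

Lemma limit_maximizers_neq0 : limit_maximizers !=set0.
Proof.
have attained k : exists t, X t /\ limit_max <= D k t.
  by have [t Xt t_high] := limit_max_attained k; exists t.
have [x /all_and2[Xx x_high]] := choice attained.
have [|t [Xt x_cluster_t]] := compactX (F := x @ \oo) _.
  by exists 0%N => // n _; exact: Xx.
exists t; split=> // k; apply: (closed_superlevel (@D_cont k)) => B nbhsB.
apply: x_cluster_t nbhsB.
by exists k => // n /= le_kn; apply: le_trans (x_high n) _; exact: D_decr.
Qed.

(* By [D_rec] the maximum at [t] is an average of values at the images of [t] that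
   are at most the maximum. *)
Lemma limit_maximizers_step t i :
  limit_maximizers t -> i \in s -> 0 < p i t -> limit_maximizers (f i t).
Proof.
set M := limit_max => -[Xt t_max] i_in p_gt0; split; first exact: f_in.
move=> j; rewrite leNgt; apply/negP => lt_j.
pose d := M - D j (f i t); have d_gt0 : 0 < d by rewrite subr_gt0.
have [m m_close] : exists m, forall u, X u -> D m u < M + p i t * d.
  by apply: limit_max_lt; rewrite ltrDl mulr_gt0.
pose k := maxn j m; pose gap i' := M + p i t * d - D k (f i' t).
have gap_ge0 i' : i' \in s -> 0 <= p i' t * gap i'.
  move=> i'_in; rewrite mulr_ge0 ?p_ge0 // subr_ge0.
  apply: le_trans (ltW (m_close _ (f_in i'_in Xt))).
  by apply: D_decr; exact: leq_maxr.
have gap_le : p i t * gap i <= p i t * d.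
  apply: (@le_trans _ _ (\sum_(i' <- s) p i' t * gap i')).
    by rewrite (big_rem i) //= lerDl big_seq sumr_ge0 // => i' /mem_rem; exact: gap_ge0.
  rewrite /gap; under eq_bigr do rewrite mulrBr.
  rewrite sumrB -mulr_suml sum_p mul1r -D_rec.
  by have := t_max k.+1; rewrite -/M; lra.
have gap_gt : d < gap i.
  have : D k (f i t) <= M - d by rewrite /d subKr; apply: D_decr; exact: leq_maxl.
  by have := mulr_gt0 p_gt0 d_gt0; rewrite /gap; lra.
by move: gap_le; rewrite leNgt ltr_pM2l // gap_gt.
Qed.

Lemma uniform_cvg0_invariant_zero :
  (forall A : set T, closed A -> A !=set0 ->
    (forall t i, A t -> i \in s -> 0 < p i t -> A (f i t)) -> exists2 t, A t & D 0 t = 0) ->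
  forall e, 0 < e -> exists k, forall t, X t -> D k t < e.
Proof.
move=> invariant_zero e e_gt0; apply: limit_max_lt; apply: le_lt_trans e_gt0.
have [t [_ t_max] <-] := invariant_zero _ closed_limit_maximizers limit_maximizers_neq0
  limit_maximizers_step.
exact: t_max.
Qed.

End MaximumPrinciple.

Lemma pi_nat_dvdn_exp (m n : nat) : (0 < m)%N -> \pi(n).-nat m -> (m %| n ^ m)%N.
Proof.
move=> m_gt0 pi_m; apply/dvdn_partP => // q q_pi_m; rewrite p_part.
have q_n : (q %| n)%N.
  move: q_pi_m; rewrite mem_primes => /and3P[prime_q _ q_m].
  by have := pnatP _ m_gt0 pi_m q prime_q q_m; rewrite mem_primes => /and3P[].
apply: (dvdn_trans (dvdn_exp2l q (ltnW (ltn_logl q m_gt0)))).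
exact: dvdn_exp2r.
Qed.

Lemma norm_ge2_neq0 (D : numDomainType) (x : D) : 2 <= `|x| -> x != 0.
Proof. by apply: contraTneq => ->; rewrite normr0 lern0. Qed.

Section InvariantSets.
Context {K : realType} (R b : int) (L : seq int).
Hypotheses (R_ge2 : 2 <= `|R|) (b_neq0 : b != 0) (L0 : 0 \in L) (condv : condition_v R L).
Hypothesis half_digits : half_integer_digits K R b L.
Implicit Types (t : K) (l : int).

Definition step l t : K := (t - l%:~R) / R%:~R.

(* The zeros of [cos (pi b t)], which weighs the steps to [t]. *)
Definition blocked (t : K) : Prop := half_integer (t * b%:~R).

Definition step_invariant (A : set K) : Prop :=
  forall t l, A t -> l \in L -> ~ blocked (step l t) -> A (step l t).

Let R_neq0 : R != 0 := norm_ge2_neq0 R_ge2.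
Let intR_neq0 : (R%:~R : K) != 0. Proof. by rewrite intr_eq0 R_neq0. Qed.

Lemma step0 t : step 0 t = t / R%:~R.
Proof. by rewrite /step subr0. Qed.

Lemma exists_step_stable_radius t :
  exists C, `|t| <= C /\ forall l s, l \in L -> `|s| <= C -> `|step l s| <= C.
Proof.
pose C := `|t| + \sum_(l <- L) `|l%:~R : K|; exists C; split; first by rewrite lerDl sumr_ge0.
move=> l s lL s_le; have C_ge0 : 0 <= C := le_trans (normr_ge0 s) s_le.
have l_le : `|l%:~R| <= C.
  by rewrite /C (big_rem l) //= addrCA lerDl addr_ge0 // sumr_ge0.
have R_ge2K : 2 <= `|R%:~R : K| by rewrite -intr_norm -[2]/(2%:~R) ler_int.
rewrite /step normrM normfV ler_pdivrMr ?normr_gt0 //; apply: le_trans (ler_normB _ _) _.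
have : C * 2 <= C * `|R%:~R : K| by rewrite ler_wpM2l.
by lra.
Qed.

Lemma even_base : exists R' : int, R = 2 * R'.
Proof.
have [l [_ [lL _ l_neq0 _ _]]] := condv.
have [n eq_lb] := (half_integer_frac K (l * b) R_neq0).1 (half_digits lL l_neq0).
by exists (R %/ 2)%Z; move: (l * b) eq_lb; clear; lia.
Qed.

Lemma step_unblocked t l : l \in L -> l != 0 -> blocked (t / R%:~R) -> ~ blocked (step l t).
Proof.
move=> lL l_neq0 blocked_t; rewrite /blocked (_ : step l t * b%:~R =
    t / R%:~R * b%:~R - (l * b)%:~R / R%:~R).
  exact: half_integerB blocked_t (half_digits lL l_neq0).
by rewrite /step rmorphM /=; ring.
Qed.

Lemma exists_unblocked_step t : exists2 l, l \in L & ~ blocked (step l t).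
Proof.
have [blocked_t|free_t] := pselect (blocked (t / R%:~R)); last by exists 0; rewrite ?step0.
have [l [_ [lL _ l_neq0 _ _]]] := condv.
by exists l => //; exact: step_unblocked.
Qed.

Section InvariantSet.
Variable A : set K.
Hypotheses (closedA : closed A) (invA : step_invariant A) (A_not0 : ~ A 0).

(* Otherwise [A] contains the path [t / R ^ k], which tends to 0. *)
Lemma invariant_blocked t : A t ->
  exists k, A (t / R%:~R ^+ k) /\ blocked (t / R%:~R ^+ k.+1).
Proof.
move=> At; apply: contrapT => never_blocked; apply: A_not0.
have A_path k : A (t / R%:~R ^+ k).
  elim: k => [|k IHk]; first by rewrite expr0 divr1.
  have step_path : t / R%:~R ^+ k.+1 = step 0 (t / R%:~R ^+ k).
    by rewrite step0 exprSr invfM mulrA.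
  rewrite step_path; apply: invA => //; rewrite -step_path => blocked_k.
  by apply: never_blocked; exists k.
have path_cvg0 : (t / R%:~R ^+ k) @[k --> \oo] --> (0 : K).
  have R_inv_lt1 : `|(R%:~R : K)^-1| < 1.
    rewrite normfV invf_lt1 ?normr_gt0 // -intr_norm.
    by apply: (@lt_le_trans _ _ 2%:~R); rewrite ?ltr1n ?ler_int.
  rewrite -(mulr0 t); under eq_fun do rewrite -exprVn.
  by apply: cvgMl_tmp; exact: cvg_expr.
by apply: (closed_cvg A closedA _ _ path_cvg0); near=> k.
Unshelve. all: by end_near.
Qed.

Lemma invariant_denominator t : A t -> exists u : int, b%:~R * t = u%:~R.
Proof.
move=> /invariant_blocked[k [_ [n blocked_n]]].
have [R' eq_R] := even_base; exists (R ^+ k * (R' * (2 * n + 1))).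
have Rk_neq0 : (R%:~R ^+ k.+1 : K) != 0 by rewrite expf_neq0.
have -> : b%:~R * t = (n%:~R + 2^-1) * R%:~R ^+ k.+1.
  by rewrite -blocked_n mulrAC mulfVK // mulrC.
by rewrite exprSr {2}eq_R !(rmorphM, rmorphXn, rmorphD) /=; field.
Qed.

Lemma invariant_forward n t : A t ->
  exists (N : int) (t' : K), A t' /\ t = N%:~R + R%:~R ^+ n * t'.
Proof.
elim: n => [|n IHn] At; first by exists 0, t; rewrite expr0 mul1r add0r.
have [N [t' [At' ->]]] := IHn At.
have [l lL free_l] := exists_unblocked_step t'.
exists (N + R ^+ n * l), (step l t'); split; first exact: invA.
by rewrite !(rmorphM, rmorphXn, rmorphD) /= exprSr /step; field.
Qed.

Let coprime_part : int := sgz b * (`|b|%N`_(\pi(`|R|)^'))%N.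

Lemma coprime_part_coprime : coprimez R coprime_part.
Proof.
rewrite coprimezE abszM absz_sg b_neq0 mul1n.
by apply: (@pnat_coprime \pi(`|R|%N)); rewrite ?pnat_pi ?absz_gt0 //; exact: part_pnat.
Qed.

Lemma invariant_coprime_denominator t : A t -> exists u : int, coprime_part%:~R * t = u%:~R.
Proof.
pose n := (`|b|%N`_(\pi(`|R|)))%N.
have eq_b : b = coprime_part * n%:Z.
  by rewrite {1}[b]intEsg /coprime_part -mulrA -PoszM mulnC partnC // absz_gt0.
have /dvdzP[e eq_Rn] : (n %| R ^+ n)%Z.
  by rewrite dvdzE abszX pi_nat_dvdn_exp ?part_gt0 ?part_pnat.
move=> /(invariant_forward n)[N [t' [/invariant_denominator[u eq_u] ->]]].
exists (coprime_part * N + e * u); rewrite mulrDr rmorphD !(rmorphM _ _ u) /= -eq_u.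
by rewrite -rmorphXn eq_Rn eq_b !rmorphM /=; ring.
Qed.

End InvariantSet.

Lemma closed_invariant_contains0 (A : set K) :
  closed A -> A !=set0 -> step_invariant A -> A 0.
Proof.
move=> closedA [t0 At0] invA; apply: contrapT => A_not0.
have [k [At blocked_t]] := invariant_blocked closedA invA A_not0 At0.
set t := t0 / R%:~R ^+ k in At; have {}blocked_t : blocked (t / R%:~R).
  by rewrite /t -mulrA -invfM -exprSr.
have A_step l : l \in L -> l != 0 -> A (step l t).
  by move=> lL l_neq0; apply: invA => //; exact: step_unblocked.
have [l1 [l2 [l1L l2L l1_neq0 l2_neq0 /negP]]] := condv; apply.
have denom := invariant_coprime_denominator closedA invA A_not0.
have [u1 eq_u1] := denom _ (A_step l1 l1L l1_neq0).
have [u2 eq_u2] := denom _ (A_step l2 l2L l2_neq0).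
rewrite -(Gauss_dvdzr _ coprime_part_coprime); apply/dvdzP; exists (u2 - u1).
by apply: (@intr_inj K); rewrite !(rmorphM, rmorphB) /= -eq_u1 -eq_u2 /step; field.
Qed.

End InvariantSets.

(** * Dual operators of a self-similar measure *)

Local Notation digits b := [:: 0; b].

Section SelfSimilar.
Context {K : realType} (mu : probability K K) (R b : int).
Hypothesis selfsim : selfsimilar R b mu.

Lemma measurable_tau (c : int) : measurable_fun setT (tau R c : K -> K).
Proof. by apply: measurable_funM => //; apply: measurable_funD. Qed.

Lemma ge0_integral_selfsimilar (f : K -> \bar K) :
    measurable_fun setT f -> (forall x, (0 <= f x)%E) ->
  (\int[mu]_x f x = (2^-1)%:E * \sum_(c <- digits b) \int[mu]_x f (tau R c x))%E.
Proof.
move=> mf f_ge0; have half_ge0 : 0 <= 2^-1 :> K by rewrite invr_ge0.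
pose taum c : {mfun K >-> K} := mfun_Sub (mem_set (measurable_tau c)).
pose image c := distribution mu (taum c).
pose mean := mscale (NngNum half_ge0) (measure_add (image 0) (image b)).
rewrite (eq_measure_integral mean) => [|A mA _]; last first.
  by etransitivity; [exact: selfsim|congr (_ * _)%E; exact/esym/measure_addE].
rewrite ge0_integral_mscale // ge0_integral_measure_add // !ge0_integral_distribution //.
by rewrite !big_cons big_nil adde0.
Qed.

Lemma rintegrable_tau (f : K -> K) (c : int) : c \in digits b ->
  rintegrable mu f -> rintegrable mu (fun x => f (tau R c x)).
Proof.
move=> c_digit int_f; have mf := rintegrable_measurable int_f.
apply/integrableP; split.
  by apply/measurable_EFinP; exact: measurableT_comp mf (measurable_tau c).
have /integrableP[_] := int_f.
rewrite (@ge0_integral_selfsimilar (fun x => `|(f x)%:E|%E)) //; last first.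
  by apply: measurableT_comp => //; exact/measurable_EFinP.
rewrite muleC -lte_pdivlMr // gt0_mulye ?lte_fin ?invr_gt0 //; apply: le_lt_trans.
rewrite (big_rem c) //= leeDl //; apply: sume_ge0 => d _.
exact: integral_ge0.
Qed.

Lemma ge0_Rintegral_selfsimilar (f : K -> K) : rintegrable mu f -> (forall x, 0 <= f x) ->
  \int[mu]_x f x = 2^-1 * \sum_(c <- digits b) \int[mu]_x f (tau R c x).
Proof.
move=> int_f f_ge0; rewrite /Rintegral ge0_integral_selfsimilar //; last first.
  exact: measurable_int int_f.
suff -> : (\sum_(c <- digits b) \int[mu]_x (f (tau R c x))%:E =
    (\sum_(c <- digits b) \int[mu]_x f (tau R c x))%:E)%E by [].
rewrite -sumEFin big_seq [RHS]big_seq; apply: eq_bigr => c c_digit.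
by rewrite /Rintegral fineK //; exact/integrable_fin_num/(rintegrable_tau c_digit).
Qed.

Lemma Rintegral_selfsimilar (f : K -> K) : rintegrable mu f ->
  \int[mu]_x f x = \int[mu]_x (2^-1 * \sum_(c <- digits b) f (tau R c x)).
Proof.
move=> int_f; have int_tau c : c \in digits b -> rintegrable mu (fun x => f (tau R c x)).
  by move=> c_digit; exact: rintegrable_tau.
rewrite RintegralZl //; last exact: rintegrable_sum.
rewrite Rintegral_sum //.
have parts g : rintegrable mu g ->
    \int[mu]_x g x = \int[mu]_x g^\+ x - \int[mu]_x g^\- x.
  move=> int_g; rewrite -RintegralB //; [|exact: integrable_funrpos|exact: integrable_funrneg].
  by apply: eq_Rintegral => x _; rewrite -[in LHS](funrposBneg g).
rewrite (parts f) // !ge0_Rintegral_selfsimilar //;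
  [|exact: integrable_funrneg|exact: integrable_funrpos].
rewrite -mulrBr -sumrB; congr (_ * _); rewrite big_seq [RHS]big_seq.
by apply: eq_bigr => c c_digit; rewrite (parts (fun x => f (tau R c x))) //; exact: int_tau.
Qed.

Lemma inL2_tau (v : K -> K[i]) (c : int) : c \in digits b ->
  inL2 mu v -> inL2 mu (fun x => v (tau R c x)).
Proof.
move=> c_digit /inL2P[meas_v int_v]; apply/inL2P; split.
  exact: cmeasurable_comp (measurable_tau c) meas_v.
exact: (rintegrable_tau c_digit int_v).
Qed.

Lemma cintegral_selfsimilar (v : K -> K[i]) : inL2 mu v ->
  cintegral mu v = cintegral mu (fun x => (2^-1)%:C%C * \sum_(c <- digits b) v (tau R c x)).
Proof.
move=> L2v; rewrite !cintegralE; congr Complex.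
  rewrite (Rintegral_selfsimilar (inL2_Re L2v)); apply: eq_Rintegral => x _.
  by rewrite !big_cons !big_nil; case: (v _) (v _) => ? ? [? ?] /=; ring.
rewrite (Rintegral_selfsimilar (inL2_Im L2v)); apply: eq_Rintegral => x _.
by rewrite !big_cons !big_nil; case: (v _) (v _) => ? ? [? ?] /=; ring.
Qed.

Lemma sqnormL2_selfsimilar (v : K -> K[i]) : inL2 mu v ->
  sqnormL2 mu v = \int[mu]_x (2^-1 * \sum_(c <- digits b) sqnormc (v (tau R c x))).
Proof. by move=> /inL2_integrable; exact: Rintegral_selfsimilar. Qed.

End SelfSimilar.

Section FrameElements.
Variables (K : realType) (R : int) (alpha : int -> K[i]).
Implicit Types (l c : int) (w : seq int) (x : K).

Lemma freq_nil : freq R [::] = 0.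
Proof. by rewrite /freq big_ord0. Qed.

Lemma freq_cons l w : freq R (l :: w) = l + R * freq R w.
Proof.
rewrite /freq big_ord_recl expr0 mul1r; congr (_ + _).
by rewrite mulr_sumr; apply: eq_bigr => i _; rewrite /= exprS mulrA.
Qed.

Lemma frame_elt_nil : frame_elt R alpha [::] = fun=> 1.
Proof.
by apply/funext => x; rewrite /frame_elt big_nil freq_nil /e_ mul0r ephase0 mulr1.
Qed.

Lemma frame_elt_zero : alpha 0 = 1 -> frame_elt R alpha [:: 0] = frame_elt R alpha [::].
Proof.
move=> alpha0; apply/funext => x.
by rewrite /frame_elt big_cons alpha0 mul1r freq_cons freq_nil mulr0.
Qed.

Lemma frame_elt_cons_tau l w c x : R != 0 ->
  frame_elt R alpha (l :: w) (tau R c x) =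
  alpha l * e_ l (tau R c x) * frame_elt R alpha w x.
Proof.
move=> R_neq0; rewrite /frame_elt big_cons freq_cons.
suff -> : e_ (l + R * freq R w) (tau R c x) = e_ l (tau R c x) * e_ (freq R w) x by ring.
rewrite /e_ rmorphD /= mulrDl ephaseD; congr (_ * _).
rewrite rmorphM /= /tau mulrC mulrA mulfVK ?intr_eq0 // mulrDl.
by rewrite -rmorphM /= ephaseDint mulrC.
Qed.

Lemma inL2_mul_frame_elt (mu : probability K K) v w : inL2 mu v ->
  inL2 mu (fun x => v x * conjc (frame_elt R alpha w x)).
Proof.
move=> L2v; under eq_fun do rewrite mulrC.
apply: (@inL2_mul_bounded _ _ (sqnormc (\prod_(l <- w) alpha l))) => // [|x].
  apply: cmeasurableJ; apply: cmeasurableM; first exact: cmeasurable_cst.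
  exact: cmeasurable_expt.
by rewrite sqnormcJ sqnormcM sqnormc_ephase mulr1.
Qed.

End FrameElements.

Section DualOperators.
Context {K : realType} (mu : probability K K) (R b : int) (L : seq int).
Variable alpha : int -> K[i].
Hypotheses (R_neq0 : R != 0) (b_neq0 : b != 0) (selfsim : selfsimilar R b mu).
Implicit Types (l : int) (k : nat) (a : K[i]) (u v : K -> K[i]).

(* The adjoint of [f |-> alpha_l e_l f(R x)] on 1-periodic functions. *)
Definition dualop l v (x : K) : K[i] :=
  (2^-1)%:C%C * \sum_(c <- digits b) conjc (alpha l * e_ l (tau R c x)) * v (tau R c x).

Lemma dualopD l u v : dualop l (fun x => u x + v x) = fun x => dualop l u x + dualop l v x.
Proof. by apply/funext => x; rewrite /dualop !big_cons !big_nil; ring. Qed.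

Lemma dualopB l u v : dualop l (fun x => u x - v x) = fun x => dualop l u x - dualop l v x.
Proof. by apply/funext => x; rewrite /dualop !big_cons !big_nil; ring. Qed.

Lemma dualopZ l a v : dualop l (fun x => a * v x) = fun x => a * dualop l v x.
Proof. by apply/funext => x; rewrite /dualop !big_cons !big_nil; ring. Qed.

Lemma inL2_dualop l v : inL2 mu v -> inL2 mu (dualop l v).
Proof.
move=> L2v; apply: inL2Z; apply: inL2_sum => c c_digit.
apply: (@inL2_mul_bounded _ _ (sqnormc (alpha l))) => [|x|]; last exact: (inL2_tau selfsim).
  apply: cmeasurableJ; apply: cmeasurableM; first exact: cmeasurable_cst.
  by apply: cmeasurable_comp (measurable_tau R c) _; exact: cmeasurable_expt.
by rewrite sqnormcJ sqnormcM sqnormc_ephase mulr1.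
Qed.

Lemma inner_frame_elt_cons v l w : inL2 mu v ->
  inner mu v (frame_elt R alpha (l :: w)) = inner mu (dualop l v) (frame_elt R alpha w).
Proof.
move=> L2v; rewrite /inner (cintegral_selfsimilar selfsim); last exact: inL2_mul_frame_elt.
congr cintegral; apply/funext => x; rewrite /dualop -mulrA mulr_suml; congr (_ * _).
by apply: eq_bigr => c _; rewrite frame_elt_cons_tau // conjcM mulrC mulrAC.
Qed.

Lemma inner_frame_elt_nil v : inner mu v (frame_elt R alpha [::]) = cintegral mu v.
Proof. by rewrite /inner frame_elt_nil; under eq_fun do rewrite conjc1 mulr1. Qed.

Lemma cintegral_dualop0 v : alpha 0 = 1 -> inL2 mu v ->
  cintegral mu (dualop 0 v) = cintegral mu v.
Proof.
by move=> alpha0 L2v; rewrite -!inner_frame_elt_nil -inner_frame_elt_cons // frame_elt_zero.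
Qed.

Lemma dualop_Mentry l v x : dualop l v x =
  ((Num.sqrt 2)^-1)%:C%C * conjc (e_ l (x / R%:~R)) *
  \sum_(c <- digits b) conjc (Mentry R alpha l c) * v (tau R c x).
Proof.
rewrite mulr_sumr /dualop mulr_sumr; apply: eq_bigr => c _.
have -> : e_ l (tau R c x) = e_ l (x / R%:~R) * ephase ((l * c)%:~R / R%:~R).
  by rewrite /e_ -ephaseD /tau rmorphM /=; congr ephase; ring.
by rewrite -(mul_sqrtVC (ler0n K 2)) /Mentry !conjcM conjc_real; ring.
Qed.

Hypothesis ortho : orthonormal_columns R b L alpha.

Lemma sum_sqnormc_dualop v x : \sum_(l <- L) sqnormc (dualop l v x) =
  2^-1 * \sum_(c <- digits b) sqnormc (v (tau R c x)).
Proof.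
have uniq_digits : uniq (digits b) by rewrite /= andbT inE eq_sym.
rewrite -(orthonormal_columns_isometry (fun c => v (tau R c x)) uniq_digits ortho).
rewrite mulr_sumr; apply: eq_bigr => l _.
by rewrite dualop_Mentry !sqnormcM sqnormcR sqnormcJ sqnormc_ephase mulr1 exprVn sqr_sqrtr.
Qed.

Lemma sum_sqnormL2_dualop v : inL2 mu v ->
  \sum_(l <- L) sqnormL2 mu (dualop l v) = sqnormL2 mu v.
Proof.
move=> L2v; rewrite (sqnormL2_selfsimilar selfsim) // -Rintegral_sum.
  by apply: eq_Rintegral => x _; exact: sum_sqnormc_dualop.
by move=> l _; exact/inL2_integrable/inL2_dualop.
Qed.

Fixpoint energy k v : K :=
  if k is k'.+1 then \sum_(l <- L) energy k' (dualop l v) else sqnormc (cintegral mu v).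

Lemma energy_ge0 k v : 0 <= energy k v.
Proof. by elim: k v => [|k IHk] v; [exact: sqr_ge0|rewrite sumr_ge0]. Qed.

Lemma energy_le k v : inL2 mu v -> energy k v <= sqnormL2 mu v.
Proof.
elim: k v => [|k IHk] v L2v; first exact: sqnormc_cintegral_le.
by rewrite -sum_sqnormL2_dualop //; apply: ler_sum => l _; apply: IHk; exact: inL2_dualop.
Qed.

Lemma energyZ k a v : inL2 mu v -> energy k (fun x => a * v x) = sqnormc a * energy k v.
Proof.
elim: k v => [|k IHk] v L2v /=; first by rewrite cintegralZ // sqnormcM.
by rewrite mulr_sumr; apply: eq_bigr => l _; rewrite dualopZ IHk //; exact: inL2_dualop.
Qed.

Lemma energy_parallelogram k u v : inL2 mu u -> inL2 mu v ->
  energy k (fun x => u x + v x) + energy k (fun x => u x - v x) =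
  2 * energy k u + 2 * energy k v.
Proof.
elim: k u v => [|k IHk] u v L2u L2v.
  by rewrite /= cintegralD // cintegralB //; exact: sqnormc_parallelogram.
rewrite -big_split !mulr_sumr -big_split; apply: eq_bigr => l _ /=.
by rewrite dualopD dualopB IHk //; exact: inL2_dualop.
Qed.

Definition defect k v := sqnormL2 mu v - energy k v.

Lemma defect_ge0 k v : inL2 mu v -> 0 <= defect k v.
Proof. by move=> L2v; rewrite subr_ge0 energy_le. Qed.

Lemma defect_le k v : defect k v <= sqnormL2 mu v.
Proof. by rewrite gerBl energy_ge0. Qed.

Lemma defectZ k a v : inL2 mu v -> defect k (fun x => a * v x) = sqnormc a * defect k v.
Proof. by move=> L2v; rewrite /defect sqnormL2Z // energyZ // mulrBr. Qed.

Lemma defectD_le k u v : inL2 mu u -> inL2 mu v ->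
  defect k (fun x => u x + v x) <= 2 * defect k u + 2 * defect k v.
Proof.
move=> L2u L2v; have := defect_ge0 k (inL2B L2u L2v).
have := energy_parallelogram k L2u L2v; have := sqnormL2_parallelogram L2u L2v.
by rewrite /defect; lra.
Qed.

Hypotheses (uniqL : uniq L) (L0 : 0 \in L) (alpha0 : alpha 0 = 1).

Lemma energyS_ge k v : inL2 mu v -> energy k v <= energy k.+1 v.
Proof.
elim: k v => [|k IHk] v L2v.
  rewrite /= (bigD1_seq 0) //= cintegral_dualop0 // lerDl.
  by rewrite sumr_ge0 // => l _; exact: sqr_ge0.
by apply: ler_sum => l _; apply: IHk; exact: inL2_dualop.
Qed.

Lemma defect_decr j k v : inL2 mu v -> (j <= k)%N -> defect k v <= defect j v.
Proof.
move=> L2v /subnK <-; elim: (k - j)%N => [//|n]; apply: le_trans.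
by rewrite lerD2l lerN2 energyS_ge.
Qed.

End DualOperators.

Section Mask.
Context {K : realType} (b : int).
Implicit Types t : K.

Definition mask t : K[i] := (2^-1)%:C%C * \sum_(c <- digits b) ephase (t * c%:~R).

Lemma sqnormc_mask t : sqnormc (mask t) = (1 + cos (2 * pi * (t * b%:~R))) / 2.
Proof.
rewrite /mask !big_cons big_nil mulr0 ephase0 addr0 sqnormcM sqnormcR sqnormcE /=.
have := cos2Dsin2 (2 * pi * (t * b%:~R)); set x := cos _; set y := sin _ => xy1.
by rewrite add0r -[y ^+ 2](addKr (x ^+ 2)) xy1; field.
Qed.

Lemma sqnormc_mask_gt0 t : ~ blocked b t -> 0 < sqnormc (mask t).
Proof.
move=> free_t; rewrite lt_neqAle sqr_ge0 andbT eq_sym sqnormc_mask mulf_neq0 //.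
by rewrite addrC addr_eq0; apply/eqP => /cos2pi_eqN1P.
Qed.

Lemma continuous_sqnormc_mask : continuous (fun t => sqnormc (mask t)).
Proof.
under eq_fun do rewrite sqnormc_mask.
move=> t; apply: cvgMr_tmp; apply: cvgD; first exact: cvg_cst.
apply: continuous_comp; last exact: continuous_cos.
by apply: cvgMl_tmp; apply: cvgMr_tmp.
Qed.

End Mask.

Section Completeness.
Context {K : realType} (mu : probability K K) (R b : int) (L : seq int).
Variable alpha : int -> K[i].
Hypotheses (R_ge2 : 2 <= `|R|) (b_neq0 : b != 0) (selfsim : selfsimilar R b mu).
Hypotheses (uniqL : uniq L) (L0 : 0 \in L) (alpha0 : alpha 0 = 1).
Hypothesis ortho : orthonormal_columns R b L alpha.
Implicit Types (k : nat) (t : K) (u v : K -> K[i]).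
Local Notation dualop := (dualop R b alpha).
Local Notation energy := (energy mu R b L alpha).
Local Notation defect := (defect mu R b L alpha).

Let R_neq0 : R != 0 := norm_ge2_neq0 R_ge2.

Lemma dualop_expt l t :
  dualop l (expt t) = fun x => conjc (alpha l) * mask b (step R l t) * expt (step R l t) x.
Proof.
apply/funext => x; rewrite /dualop /mask mulrCA -2!mulrA mulr_suml [in RHS]mulr_sumr.
congr (_ * _).
apply: eq_bigr => c _; rewrite conjcM -mulrA; congr (_ * _).
rewrite /e_ /expt -ephaseN -!ephaseD /tau /step; congr ephase.
by field; rewrite intr_eq0.
Qed.

Definition transprob (l : int) t : K := sqnormc (alpha l) * sqnormc (mask b (step R l t)).

Lemma sqnormL2_dualop_expt l t : sqnormL2 mu (dualop l (expt t)) = transprob l t.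
Proof.
rewrite dualop_expt sqnormL2Z; last exact: inL2_expt.
by rewrite sqnormL2_expt mulr1 sqnormcM sqnormcJ.
Qed.

Lemma sum_transprob t : \sum_(l <- L) transprob l t = 1.
Proof.
rewrite -(sqnormL2_expt mu t) -(sum_sqnormL2_dualop b_neq0 selfsim ortho (inL2_expt mu t)).
by apply: eq_bigr => l _; rewrite sqnormL2_dualop_expt.
Qed.

Lemma transprob_ge0 l t : 0 <= transprob l t.
Proof. by rewrite mulr_ge0 ?sqr_ge0. Qed.

Lemma defect_exptS k t : defect k.+1 (expt t) =
  \sum_(l <- L) transprob l t * defect k (expt (step R l t)).
Proof.
rewrite /defect -(sum_sqnormL2_dualop b_neq0 selfsim ortho (inL2_expt mu t)) -sumrB.
apply: eq_bigr => l _; rewrite dualop_expt.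
rewrite [LHS](defectZ L alpha selfsim k _ (inL2_expt mu _)).
by rewrite sqnormcM sqnormcJ.
Qed.

Lemma defect0_expt0 : defect 0 (expt 0) = 0.
Proof.
rewrite /defect sqnormL2_expt expt0 /= cintegralE !Rintegral_cst_prob.
by rewrite sqnormcE /= expr1n expr0n addr0 subrr.
Qed.

Lemma continuous_defect_expt k : continuous (fun t => defect k (expt t)).
Proof.
elim: k => [|k IHk].
  rewrite /defect; under eq_fun do rewrite sqnormL2_expt.
  by move=> t; apply: cvgB; [exact: cvg_cst|exact: continuous_sqnormc_cintegral_expt].
under eq_fun do rewrite defect_exptS.
apply: continuous_big => [|l _ t]; first exact: add_continuous.
have step_cvg : step R l s @[s --> t] --> step R l t.
  by apply: cvgMr_tmp; apply: cvgB => //; exact: cvg_cst.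
apply: cvgM.
  by apply: cvgMl_tmp; exact: (continuous_cvg _ (@continuous_sqnormc_mask K b _) step_cvg).
exact: (continuous_cvg _ (IHk _) step_cvg).
Qed.

Hypotheses (alpha_neq0 : {in L, forall l, alpha l != 0}) (condv : condition_v R L).
Hypothesis half_digits : half_integer_digits K R b L.

Lemma transprob_gt0 l t : l \in L -> ~ blocked b (step R l t) -> 0 < transprob l t.
Proof.
move=> lL free_l; rewrite mulr_gt0 ?sqnormc_mask_gt0 //.
by rewrite lt_neqAle sqr_ge0 eq_sym sqnormc_eq0 alpha_neq0.
Qed.

Definition parseval_at v : Prop := inL2 mu v /\ forall e, 0 < e -> exists k, defect k v < e.

Lemma parseval_at_expt t : parseval_at (expt t).
Proof.
split; first exact: inL2_expt.
have [C [t_le C_stable]] := exists_step_stable_radius L R_ge2 t.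
pose X : set K := `[- C, C]%classic.
have inX s : X s <-> `|s| <= C by rewrite /X /= in_itv /= ler_norml.
have defect_cvg0 : forall e, 0 < e -> exists k, forall s, X s -> defect k (expt s) < e.
  apply: (@uniform_cvg0_invariant_zero _ _ X _ L transprob (step R)).
  - exact: segment_compact.
  - exact: interval_closed.
  - by exists t; exact/inX.
  - by move=> l s lL /inX s_le; apply/inX; exact: C_stable.
  - by move=> l s _; exact: transprob_ge0.
  - exact: sum_transprob.
  - exact: continuous_defect_expt.
  - by move=> k s; apply: defect_ge0 => //; exact: inL2_expt.
  - by move=> j k s le_jk; apply: defect_decr => //; exact: inL2_expt.
  - exact: defect_exptS.
  move=> A closedA A_neq0 invA; exists 0; last exact: defect0_expt0.
  apply: (closed_invariant_contains0 R_ge2 b_neq0 L0 condv half_digits) => // s l As lL free_l.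
  by apply: invA => //; exact: transprob_gt0.
by move=> e /defect_cvg0[k defect_lt]; exists k; apply: defect_lt; exact/inX.
Qed.

Lemma closed_subspace_parseval_at : closed_subspace mu parseval_at.
Proof.
split=> [v []//|u v [L2u u_small] [L2v v_small]|a v [L2v v_small]|v L2v approx].
- split; first exact: inL2D.
  move=> e e_gt0; have e4_gt0 : 0 < e / 4 by rewrite divr_gt0.
  have [i defect_u] := u_small _ e4_gt0; have [j defect_v] := v_small _ e4_gt0.
  exists (maxn i j).
  apply: le_lt_trans (defectD_le _ _ _ _ L2u L2v) _ => //.
  have := defect_decr R_neq0 selfsim uniqL L0 alpha0 L2u (leq_maxl i j).
  have := defect_decr R_neq0 selfsim uniqL L0 alpha0 L2v (leq_maxr i j); lra.
- split; first exact: inL2Z.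
  move=> e e_gt0; have a_gt0 : 0 < sqnormc a + 1 by rewrite ltr_wpDl ?sqr_ge0.
  have [k defect_v] := v_small _ (divr_gt0 e_gt0 a_gt0); exists k; rewrite defectZ //.
  apply: (@le_lt_trans _ _ ((sqnormc a + 1) * defect k v)).
    by rewrite ler_wpM2r ?defect_ge0 // lerDl.
  by rewrite mulrC -ltr_pdivlMr.
split=> // e e_gt0; have e4_gt0 : 0 < e / 4 by rewrite divr_gt0.
have [u [[L2u u_small] close_uv]] := approx _ e4_gt0.
have [k defect_u] := u_small _ e4_gt0; exists k.
have -> : v = (fun x => u x + (v x - u x)) by apply/funext => x; rewrite addrC subrK.
apply: le_lt_trans (defectD_le _ _ _ _ L2u (inL2B L2v L2u)) _ => //.
by have := defect_le mu R b L alpha k (fun x => v x - u x); lra.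
Qed.

Lemma parseval_at_inL2 v : inL2 mu v -> parseval_at v.
Proof. exact: (exponentials_total closed_subspace_parseval_at parseval_at_expt). Qed.

End Completeness.

(** * The Parseval identity *)

Section Words.
Variable L : seq int.
Implicit Types (k : nat) (l : int) (w : seq int).

Fixpoint words k : seq (seq int) :=
  if k is k'.+1 then
    [::] :: [seq lw <- [seq l :: w | l <- L, w <- words k'] | lw != [:: 0]]
  else [:: [::]].

Lemma nil_words k : [::] \in words k.
Proof. by case: k => [|k]; rewrite inE. Qed.

Lemma cons_wordsS k l w :
  (l :: w \in words k.+1) = [&& l \in L, w \in words k & l :: w != [:: 0]].
Proof.
rewrite /= inE /= mem_filter andbC andbA; congr (_ && _).
apply/allpairsP/andP => [[[l' w'] /= [? ? [-> ->]]] //|[lL wk]].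
by exists (l, w).
Qed.

Lemma uniq_cons_words (s : seq (seq int)) :
  uniq L -> uniq s -> uniq [seq l :: w | l <- L, w <- s].
Proof. by move=> uniqL uniqs; apply: allpairs_uniq => // -[? ?] [? ?] _ _ /= [-> ->]. Qed.

Lemma uniq_words k : uniq L -> uniq (words k).
Proof.
move=> uniqL; elim: k => //= k IHk; apply/andP; split.
  by rewrite mem_filter /=; apply/negP => /allpairsP[[? ?] [_ _ //]].
exact/filter_uniq/uniq_cons_words.
Qed.

Lemma words_Omega k w : w \in words k -> Omega L w.
Proof.
elim: k w => [|k IHk] [|l w] //; try by move=> _; split=> //; left.
rewrite cons_wordsS => /and3P[lL /IHk[allL last_w] neq0]; split; first by rewrite /= lL.
right; move: last_w neq0; case: w allL => [_ _|l' w _ [] //].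
by rewrite /= eqseq_cons eqxx andbT.
Qed.

Lemma Omega_words k w : Omega L w -> (size w <= k)%N -> w \in words k.
Proof.
elim: k w => [|k IHk] [|l w] // [/= /andP[lL allL] [//|last_lw]] size_w.
rewrite cons_wordsS lL /=; apply/andP; split; last first.
  by apply: contraNneq last_lw => -[-> ->].
by apply: IHk => //; split=> //; case: w last_lw {allL size_w} => [|l' w]; [left|right].
Qed.

Lemma finite_Omega_words (X : set (seq int)) : finite_set X -> X `<=` Omega L ->
  exists k, X `<=` [set` words k].
Proof.
move=> finX XO; exists (\max_(w <- finmap.enum_fset (fset_set X)) size w)%N => w Xw.
apply: Omega_words; first exact: XO.
by apply: leq_bigmax_seq => //; rewrite in_fset_set // inE.
Qed.

End Words.

Lemma esum_exhaustion (K : realType) (T : choiceType) (A : set T) (F : T -> K)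
    (W : nat -> seq T) (S : K) :
    (forall i, 0 <= F i) -> (forall k, uniq (W k)) -> (forall k, [set` W k] `<=` A) ->
    (forall X, finite_set X -> X `<=` A -> exists k, X `<=` [set` W k]) ->
    (forall k, \sum_(i <- W k) F i <= S) ->
    (forall e, 0 < e -> exists k, S - e < \sum_(i <- W k) F i) ->
  (\esum_(i in A) (F i)%:E = S%:E)%E.
Proof.
move=> F_ge0 uniqW WA exhaust sum_le sum_gt.
have sumE k : (\sum_(i \in [set` W k]) (F i)%:E = (\sum_(i <- W k) F i)%:E)%E.
  by rewrite -fsbig_seq ?sumEFin.
apply/eqP; rewrite eq_le; apply/andP; split.
  apply: ge_ereal_sup => _ [X [finX XA] <-]; have [k XW] := exhaust X finX XA.
  apply: (@le_trans _ _ (\sum_(i <- W k) F i)%:E); last by rewrite lee_fin sum_le.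
  rewrite -sumE; apply: lee_fsum_nneg_subset => // [i|i _]; last by rewrite lee_fin.
  by rewrite !inE; exact: XW.
apply/lee_addgt0Pr => e /sum_gt[k /ltW]; rewrite lerBlDr -lee_fin EFinD => S_le.
apply: le_trans S_le _; rewrite leeD2r //; apply: esum_ge.
by exists [set` W k]; [split; [exact: finite_seq|exact: WA]|rewrite sumE].
Qed.

Section Parseval.
Context {K : realType} (mu : probability K K) (R b : int) (L : seq int).
Variable alpha : int -> K[i].
Hypotheses (R_neq0 : R != 0) (b_neq0 : b != 0) (selfsim : selfsimilar R b mu).
Hypotheses (uniqL : uniq L) (L0 : 0 \in L) (alpha0 : alpha 0 = 1).
Local Notation energy := (energy mu R b L alpha).

Lemma sum_words k v : inL2 mu v ->
  \sum_(w <- words L k) sqnormc (inner mu v (frame_elt R alpha w)) = energy k v.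
Proof.
elim: k v => [|k IHk] v L2v; first by rewrite big_seq1 inner_frame_elt_nil.
pose F w := sqnormc (inner mu v (frame_elt R alpha w)).
have <- : \sum_(w <- [seq l :: w | l <- L, w <- words L k]) F w = energy k.+1 v.
  rewrite big_allpairs_dep /=; apply: eq_bigr => l _.
  rewrite -IHk; last exact: inL2_dualop.
  by apply: eq_bigr => w _; rewrite /F (inner_frame_elt_cons alpha R_neq0 selfsim).
rewrite /= big_cons big_filter (bigD1_seq [:: 0]) /=; first by rewrite /F frame_elt_zero.
  by apply/allpairsP; exists (0, [::]); split=> //; exact: nil_words.
exact/uniq_cons_words/uniq_words.
Qed.

Hypothesis ortho : orthonormal_columns R b L alpha.

Lemma parseval_at_frame :
  (forall v, inL2 mu v -> parseval_at mu R b L alpha v) ->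
  parseval_frame (Omega L) mu (frame_elt R alpha).
Proof.
move=> parseval_at_L2 v L2v; rewrite [RHS](_ : _ = (sqnormL2 mu v)%:E); last first.
  by rewrite /sqnormL2 /Rintegral fineK //; exact/integrable_fin_num/inL2_integrable.
apply: (esum_exhaustion (W := words L)) => [w|k|k w|X|k|e e_gt0].
- exact: sqr_ge0.
- exact: uniq_words.
- exact: words_Omega.
- exact: finite_Omega_words.
- by rewrite sum_words // energy_le.
have [_ /(_ e e_gt0)[k defect_lt]] := parseval_at_L2 v L2v.
by exists k; rewrite sum_words //; move: defect_lt; rewrite /defect; lra.
Qed.

End Parseval.

Theorem theorem5p6 (K : realType) (R b : int) (L : seq int) (alpha : int -> K[i]) :
  (2 <= `|R|)%R -> b != 0 -> uniq L -> 0 \in L ->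
  (forall l, l \in L -> alpha l != 0) -> alpha 0 = 1 ->
  (orthonormal_columns R b L alpha <-> conditions_i_iv R b L alpha) /\
  (conditions_i_iv R b L alpha -> condition_v R L ->
   forall mu : probability K K, selfsimilar R b mu ->
     parseval_frame (Omega L) mu (frame_elt R alpha)).
Proof.
move=> R_ge2 b_neq0 uniqL L0 alpha_neq0 alpha0.
have R_neq0 := norm_ge2_neq0 R_ge2.
have conditionsP := conditions_i_ivP L alpha R_neq0 b_neq0.
have orthoP := orthonormal_columnsP R b_neq0 uniqL L0 alpha0 alpha_neq0.
have ortho_conditions := iff_trans orthoP (iff_sym conditionsP).
split=> // conditions condv mu selfsim; have ortho := ortho_conditions.2 conditions.
have [half_digits _] := conditionsP.1 conditions.
by apply: (parseval_at_frame R_neq0 b_neq0 selfsim) => // v; exact: parseval_at_inL2.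
Qed.
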